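(* Let $n,k\geq 1$. For any nonempty permutation $\tau$, we have $$|\mathcal{AI}_n(I_k\oplus\tau)| = |\mathcal{AI}_n(J_k\oplus\tau)|.$$
   Context: A permutation $\pi=\pi_1\pi_2\cdots\pi_n$ of $\{1,\ldots,n\}$ is alternating if $\pi_1<\pi_2>\pi_3<\pi_4>\cdots$, and is an involution if $\pi=\pi^{-1}$. $\mathcal{AI}_n$ is the set of permutations of length $n$ that are both alternating and involutions. A permutation $\pi$ contains a pattern $\sigma\in\mathcal{S}_m$ if some subsequence of $\pi$ of length $m$ is order isomorphic to $\sigma$; otherwise $\pi$ avoids $\sigma$. $\mathcal{AI}_n(\sigma)$ is the set of $\sigma$-avoiding elements of $\mathcal{AI}_n$. $I_k=12\cdots k$ and $J_k=k\cdots 21$. For $\pi\in\mathcal{S}_a$ and $\sigma\in\mathcal{S}_b$, the direct sum is $\pi\oplus\sigma=\pi_1\cdots\pi_a(\sigma_1+a)\cdots(\sigma_b+a)$. *)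

(* Defs.v *)
From mathcomp Require Import all_boot all_fingroup.

Set Implicit Arguments.
Unset Strict Implicit.
Unset Printing Implicit Defensive.

(* Permutations of {1, ..., n} are elements of 'S_n, acting on
   {0, ..., n.-1}; positions and values are both shifted down by one. *)

(* s_1 < s_2 > s_3 < ...: with 0-based positions, the ascents are
   exactly at the even positions. *)
Definition alternating n (s : 'S_n) : bool :=
  [forall i : 'I_n, forall j : 'I_n,
     (j == i.+1 :> nat) ==> (if odd i then s j < s i else s i < s j)].

Definition involution n (s : 'S_n) : bool := s == (s^-1)%g.

(* f lists the positions of a subsequence of s order isomorphic to p. *)
Definition occurrence m n (p : 'S_m) (s : 'S_n) (f : {ffun 'I_m -> 'I_n}) :=
  [forall i : 'I_m, forall j : 'I_m, (i < j) ==> (f i < f j)] &&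
  [forall i : 'I_m, forall j : 'I_m, (s (f i) < s (f j)) == (p i < p j)].

Definition contains m n (s : 'S_n) (p : 'S_m) : bool :=
  [exists f : {ffun 'I_m -> 'I_n}, occurrence p s f].

Definition avoids m n (s : 'S_n) (p : 'S_m) : bool := ~~ contains s p.

Definition AI n : {set 'S_n} := [set s | alternating s && involution s].

Definition AI_av n m (p : 'S_m) : {set 'S_n} := [set s in AI n | avoids s p].

Definition incr_perm k : 'S_k := 1%g.

Definition decr_perm k : 'S_k := perm (@rev_ord_inj k).

Definition dsum_fun a b (p : 'S_a) (q : 'S_b) (i : 'I_(a + b)) : 'I_(a + b) :=
  match split i with
  | inl x => lshift b (p x)
  | inr y => rshift a (q y)
  end.

Lemma dsum_fun_inj a b (p : 'S_a) (q : 'S_b) : injective (dsum_fun p q).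
Proof.
move=> i j; rewrite /dsum_fun -[i]splitK -[j]splitK.
case: (split i) => x; case: (split j) => y; rewrite !unsplitK /= => /eqP.
- by rewrite eq_lshift => /eqP/perm_inj ->.
- by rewrite eq_lrshift.
- by rewrite eq_rlshift.
- by rewrite eq_rshift => /eqP/perm_inj ->.
Qed.

Definition dsum a b (p : 'S_a) (q : 'S_b) : 'S_(a + b) :=
  perm (@dsum_fun_inj a b p q).

(* Main.v *)
Require Import Defs.
From mathcomp Require Import all_boot all_fingroup.
From mathcomp Require Import all_algebra zify.

Set Implicit Arguments.
Unset Strict Implicit.
Unset Printing Implicit Defensive.

Import GRing.Theory.

(** Call a cell (i, j) of a permutation matrix inner if tau or its inverse
occurs strictly to the north-east of it.  For an involution the inner cells form
a symmetric Ferrers shape, and for p = I_k or J_k the involution contains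
p (+) tau iff it has an occurrence of p contained in a rectangle whose
north-east corner is an inner cell ([containsP]).  Involutions are compared
inside classes where the shape and the dots outside it are fixed.  The members
of a class differ only by a symmetric filling of the shape with prescribed
nonempty rows and columns: moving the inner dots does not change the shape
([inside_eq]).

Alternation restricts such a filling in a simple way.  If a peak (an odd
position, counting from 0) has an inner dot, then so do both neighbouring
valleys, and the three columns have the same height ([peak_nbr]); a comparison
between an inner and an outer dot has the same outcome for the whole class
([outer_classP]).  So the inner columns split into runs valley, peak, valley,
..., valley of odd length, inside which ascents and descents alternate,
beginning with an ascent and ending with a descent.

Fomin's growth diagrams turn a filling into the sequence of partitions met along
the boundary of the shape.  For a symmetric filling this sequence is a
palindrome, hence given by its first half, a walk which starts at the empty
partition and adds or removes one box at a time.  The longest increasing chain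
that fits in the shape is the largest first row met by the walk ([inc_chainP]),
the longest decreasing chain is the largest number of rows ([dec_chainP]), and
two neighbouring columns of the same height form an ascent iff the second box
is not placed in a lower row than the first ([asc_label]).  Thus the members of
a class avoiding I_k (+) tau correspond to the walks in a box with k - 1 columns,
and those avoiding J_k (+) tau to the walks in a box with k - 1 rows.

Conjugating all partitions exchanges the two boxes, but it also exchanges
ascents and descents, so that the pattern ADAD...AD of a run becomes DADA...DA.
This is the reverse of the original pattern, and the number of chains from mu to
nu with a given ascent pattern does not change when the pattern is reversed
([wsum_rev]): inclusion and exclusion expresses it through the operators which
add a horizontal strip, and these commute by the Bender-Knuth involution
([bk_card]).  In other words, a ribbon Schur function is invariant under rotation
of the ribbon by 180 degrees.  Replacing the runs one after the other, the two
numbers of walks agree ([nwalk_conj]). *)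

(** * Growth diagrams with edge labels *)

(** Fomin's local rule, read on the edges of a cell.  The label of an edge is
the number r > 0, counted from 1, of the row of the partition that gains a box
when the edge is crossed upwards or to the right, or 0 if the partition does not
change.  Different labels pass through each other, equal labels r > 0 both
become r + 1, and a dot turns two labels 0 into labels 1.  The top label is
[grow] of the bottom and the left one; the right label is [grow] of the left and
the bottom one. *)
Definition grow (b l : nat) (d : bool) : nat :=
  if b == l then (if b == 0 then d : nat else b.+1) else b.

Implicit Types (X : nat -> nat -> bool) (h v : nat -> nat -> nat).

(** Labels on the staircase with cells x + y + 2 <= N: [h x y] and [v x y] are
the labels of the bottom and of the left edge of cell (x, y). *)
Definition growth N (X : nat -> nat -> bool) (h v : nat -> nat -> nat) :=
  [/\ forall x, x < N -> h x 0 = 0, forall y, y < N -> v 0 y = 0 &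
   forall x y, x + y + 2 <= N ->
   [/\ h x y.+1 = grow (h x y) (v x y) (X x y),
       v x.+1 y = grow (v x y) (h x y) (X x y) &
       X x y -> h x y = 0 /\ v x y = 0]].

Lemma growth_tr N X h v : growth N X h v ->
  growth N (fun x y => X y x) (fun x y => v y x) (fun x y => h y x).
Proof.
case=> h0 v0 H; split=> // x y le; case: (H y x _); first lia.
by move=> -> -> dd; split=> // /dd [].
Qed.

Lemma growth_det N X X' h v h' v' : growth N X h v -> growth N X' h' v' ->
  (forall x y, x + y + 2 <= N -> X x y = X' x y) ->
  forall x y, x + y < N -> h x y = h' x y /\ v x y = v' x y.
Proof.
move=> [h0 v0 H] [h0' v0' H'] eX x y.
have [m] := ubnP (x + y); elim: m x y => // m IH x y ltm lt.
split.
- case: y ltm lt => [|y] ltm lt; first by rewrite h0 ?h0' //; lia.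
  have lec : x + y + 2 <= N by lia.
  case: (H x y lec) => -> _ _; case: (H' x y lec) => -> _ _.
  by case: (IH x y) => [||-> ->]; try lia; rewrite eX.
- case: x ltm lt => [|x] ltm lt; first by rewrite v0 ?v0' //; lia.
  have lec : x + y + 2 <= N by lia.
  case: (H x y lec) => _ -> _; case: (H' x y lec) => _ -> _.
  by case: (IH x y) => [||-> ->]; try lia; rewrite eX.
Qed.

Lemma grow_inj (b l : nat) (d : bool) (b' l' : nat) (d' : bool) : (d -> b = 0 /\ l = 0) ->
  (d' -> b' = 0 /\ l' = 0) ->
  grow b l d = grow b' l' d' -> grow l b d = grow l' b' d' ->
  [/\ b = b', l = l' & d = d'].
Proof.
rewrite /grow => H H'.
case: d H => [[] // -> ->|_]; case: d' H' => [[] // -> ->|_] /=;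
  do ! case: ifP => ? /=; split; lia.
Qed.

(** The local rule is reversible, dot included ([grow_inj]), so the corners of
the staircase can be peeled off one level at a time. *)
Lemma growth_boundary_det N X X' h v h' v' : growth N X h v -> growth N X' h' v' ->
  (forall x y, x + y + 1 = N -> h x y = h' x y /\ v x y = v' x y) ->
  forall x y, x + y + 2 <= N -> X x y = X' x y.
Proof.
move=> [h0 v0 H] [h0' v0' H'] eB.
have K m : forall x y, x + y + m.+1 = N -> h x y = h' x y /\ v x y = v' x y.
  elim: m => [|m IH] x y e; first exact: eB.
  have lec : x + y + 2 <= N by lia.
  case: (H x y lec) (H' x y lec) => e1 e2 e3 [f1 f2 f3].
  case: (IH x y.+1) => [|g1 _]; first lia.
  case: (IH x.+1 y) => [|_ g2]; first lia.
  by case: (grow_inj e3 f3); rewrite -?e1 -?e2 -?f1 -?f2.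
move=> x y lec; case: (H x y lec) (H' x y lec) => e1 e2 e3 [f1 f2 f3].
case: (K (N - x - y.+2) x y.+1) => [|g1 _]; first lia.
case: (K (N - x - y.+2) x.+1 y) => [|_ g2]; first lia.
by case: (grow_inj e3 f3); rewrite -?e1 -?e2 -?f1 -?f2.
Qed.

Fixpoint column_labels (v : nat -> nat) (d : nat -> bool) y :=
  if y is y'.+1 then grow (column_labels v d y') (v y') (d y') else 0.
Fixpoint vlab (X : nat -> nat -> bool) x y :=
  if x is x'.+1 then grow (vlab X x' y) (column_labels (vlab X x') (X x') y) (X x' y) else 0.
Definition hlab X x y := column_labels (vlab X x) (X x) y.

Lemma grow_gt0 (b l : nat) (d : bool) : 0 < grow b l d -> 0 < b \/ d.
Proof.
rewrite /grow; case: d; first by right.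
by left; move: H; do ! case: ifP => /= ?; lia.
Qed.

Lemma hlab_gt0 X x y : 0 < hlab X x y -> exists2 y', y' < y & X x y'.
Proof.
elim: y => [|y IH] //= /grow_gt0 [/IH[y' lt Xy]|Xy]; last by exists y.
by exists y' => //; lia.
Qed.

Lemma vlab_gt0 X x y : 0 < vlab X x y -> exists2 x', x' < x & X x' y.
Proof.
elim: x => [|x IH] //= /grow_gt0 [/IH[y' lt Xy]|Xy]; last by exists x.
by exists y' => //; lia.
Qed.

Lemma growth_lab N X :
  (forall x y y', X x y -> X x y' -> y = y') ->
  (forall x x' y, X x y -> X x' y -> x = x') ->
  growth N X (hlab X) (vlab X).
Proof.
move=> fX iX; split=> // x y _; split=> // Xxy; split; apply/eqP; rewrite -leqn0 leqNgt;
  apply/negP.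
- by move/hlab_gt0 => [y' lt /(fX _ _ _ Xxy) e]; rewrite e ltnn in lt.
- by move/vlab_gt0 => [y' lt /(iX _ _ _ Xxy) e]; rewrite e ltnn in lt.
Qed.

Section Growth.
Variables (N : nat) (X : nat -> nat -> bool) (h v : nat -> nat -> nat).
Hypothesis G : growth N X h v.

Let h0 x : x < N -> h x 0 = 0. Proof. by case: G => H _ _; exact: H. Qed.
Let v0 y : y < N -> v 0 y = 0. Proof. by case: G => _ H _; exact: H. Qed.
Let cell x y : x + y + 2 <= N ->
   [/\ h x y.+1 = grow (h x y) (v x y) (X x y),
       v x.+1 y = grow (v x y) (h x y) (X x y) &
       X x y -> h x y = 0 /\ v x y = 0].
Proof. by case: G => _ _ H; exact: H. Qed.

(** The form in which the local rule is used below: either two equal labels meet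
and grow, or both labels pass unchanged. *)
Lemma cell_cases x y : x + y + 2 <= N ->
  [\/ [/\ h x y = v x y, h x y.+1 = (h x y).+1, v x.+1 y = (v x y).+1 & (0 < h x y) || X x y]
    | [/\ h x y.+1 = h x y, v x.+1 y = v x y, ~~ X x y & (h x y <> v x y) \/ (h x y = 0 /\
      v x y = 0)]].
Proof.
move=> lec; case: (cell lec) => -> ->; rewrite /grow eq_sym.
case: eqP => [e|ne].
  rewrite -e; case: eqP => [e0|ne0].
    rewrite e0; case: (X x y) => H; [left|right]; split => //; first by right; lia.
  by case: (X x y) => [[]|_] //; left; split => //; lia.
case: (X x y) => [[]|_] //; first lia.
by right; split => //; left; lia.
Qed.

(** The cells at which the label [r.+1] arises: the dots for r = 0, and the
crossings of two lines labelled r for r > 0.  The latter are the points of the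
r-th skeleton in Viennot's shadow construction. *)
Definition birth r x y :=
  [&& x + y + 2 <= N, h x y == r, v x y == r, h x y.+1 == r.+1 & v x.+1 y == r.+1].

Lemma birth0 x y : x + y + 2 <= N -> birth 0 x y = X x y.
Proof.
move=> lec; rewrite /birth lec /=.
case: (cell_cases lec) => [][e1 e2 e3 e4].
- by apply/and4P/idP => [[/eqP a _ _ _]|Xxy]; [move: e4;
    rewrite a | case: (cell lec) => _ _ /(_ Xxy)[]; split; lia].
- by rewrite (negPf e3); apply/negP => /and4P[]; lia.
Qed.

Lemma h_step x y : x + y + 2 <= N -> h x y <= h x y.+1 <= (h x y).+1.
Proof. by move=> /cell_cases[][]; lia. Qed.

Lemma h_mono x y y' : y <= y' -> x + y' < N -> h x y <= h x y'.
Proof.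
move=> le lt; elim: y' le lt => [|y' IH] le lt; first by have -> : y = 0 by lia.
move: le; rewrite leq_eqVlt => /predU1P[->//|le].
apply: leq_trans (IH _ _) _; try lia.
by case/andP: (@h_step x y' ltac:(lia)).
Qed.

Lemma h_le x y : x + y < N -> h x y <= y.
Proof.
elim: y => [|y IH] lt; first by rewrite h0; lia.
by have := IH ltac:(lia); have := @h_step x y ltac:(lia); lia.
Qed.

Lemma birth_in_col r x y y' : y <= y' -> x + y' < N -> h x y <= r < h x y' ->
  exists2 z, y <= z < y' & birth r x z.
Proof.
move=> le; elim: y' le => [|y' IH] le lt hr; first by have e : y = 0 := ltac:(lia);
  rewrite e in hr; lia.
move: le; rewrite leq_eqVlt => /predU1P[e|le]; first by rewrite e in hr; lia.
case: (ltnP r (h x y')) => [lt'|ge].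
  by have [|||z ? ?] := IH; try lia; exists z => //; lia.
exists y'; first lia.
have lec : x + y' + 2 <= N by lia.
case: (cell_cases lec); rewrite /birth lec; case=> *; lia.
Qed.

End Growth.

Lemma birth_tr N h v r x y :
  birth N (fun x y => v y x) (fun x y => h y x) r x y = birth N h v r y x.
Proof. by rewrite /birth addnC; lia. Qed.

(** * Decreasing chains and large labels *)

Section Chains.
Variables (N : nat) (X : nat -> nat -> bool) (h v : nat -> nat -> nat).
Hypothesis G : growth N X h v.
Notation born := (birth N h v).

Lemma v_mono x x' y : x <= x' -> x' + y < N -> v x y <= v x' y.
Proof. by move=> le lt; apply: (h_mono (growth_tr G)) => //; lia. Qed.

Lemma birth_in_row r x x' y : x <= x' -> x' + y < N -> v x y <= r < v x' y ->
  exists2 z, x <= z < x' & born r z y.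
Proof.
move=> le lt hr; case: (birth_in_col (growth_tr G) le _ hr); first lia.
by move=> z lz; rewrite birth_tr => bz; exists z.
Qed.

Definition goes_se (p q : nat * nat) := (p.1 < q.1) && (q.2 < p.2).

(** Without such a cell the horizontal line labelled [r.+1] that starts at (xa,
ya) and the vertical one that starts at (xb, yb) would reach the cell (xb, ya)
unchanged, and meeting there they would make it a birth. *)
Lemma birth_between r xa ya xb yb : born r xa ya -> born r xb yb ->
  xa < xb -> yb < ya -> xb + ya + 2 <= N ->
  exists x y, [/\ born r.+1 x y, xa < x <= xb & yb < y <= ya].
Proof.
move=> Ba Bb lx ly lc; move: (Ba) (Bb) => /and5P[_ _ _ _ /eqP va] /and5P[_ _ _ /eqP hb _].
have va' : v xa.+1 ya <= v xb ya by apply: v_mono; lia.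
have hb' : h xb yb.+1 <= h xb ya by apply: (h_mono G); lia.
case: (ltnP r.+1 (v xb.+1 ya)) => [lv|gv].
  have [|||z lz bz] := @birth_in_row r.+1 xa.+1 xb.+1 ya; try lia.
  by exists z, ya; split => //; lia.
case: (ltnP r.+1 (h xb ya.+1)) => [lv|gh].
  have [|||z lz bz] := @birth_in_col _ _ _ _ G r.+1 xb yb.+1 ya.+1; try lia.
  by exists xb, z; split => //; lia.
by case: (cell_cases G lc) => [][]; lia.
Qed.

(** The line labelled [r.+1] entering (xa, ya) from below and the one entering
(xb, yb) from the left are born inside the rectangle: otherwise both would pass
the cell (xa, yb), where two equal labels cannot pass unchanged. *)
Lemma birth_between_prev r xa ya xb yb : born r.+1 xa ya -> born r.+1 xb yb ->
  xa < xb -> yb < ya ->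
  exists x y, [/\ born r x y, xa <= x < xb & yb <= y < ya].
Proof.
move=> Ba Bb lx ly; move: (Ba) (Bb) => /and5P[la /eqP ha _ _ _] /and5P[lb _ /eqP vb _ _].
case: (ltnP r (h xa yb)) => [lh|gh]; last first.
  have [|||z lz bz] := @birth_in_col _ _ _ _ G r xa yb ya; try lia.
  by exists xa, z; split => //; lia.
case: (ltnP r (v xa yb)) => [lv|gv]; last first.
  have [|||z lz bz] := @birth_in_row r xa xb yb; try lia.
  by exists z, yb; split => //; lia.
have h1 : h xa yb.+1 <= h xa ya by apply: (h_mono G); lia.
have v1 : v xa.+1 yb <= v xb yb by apply: v_mono; lia.
have h2 : h xa yb <= h xa ya by apply: (h_mono G); lia.
have v2 : v xa yb <= v xb yb by apply: v_mono; lia.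
have lc : xa + yb + 2 <= N by lia.
by case: (cell_cases G lc) => [][]; lia.
Qed.

Definition inrect r a b (p : nat * nat) := [&& born r p.1 p.2, p.1 <= a & p.2 <= b].

(** Interleaving the points of a chain by [birth_between]; the last conjunct
keeps the new points in order during the induction. *)
Lemma chain_down r a b q s : a + b + 2 <= N -> path goes_se q s -> all (inrect r a b) (q :: s) ->
  exists s', [/\ size s' = size s, sorted goes_se s', all (inrect r.+1 a b) s' &
              all (fun p => (q.1 < p.1) && (p.2 <= q.2)) s'].
Proof.
move=> lc; elim: s q => [|q2 s IH] q /=; first by exists [::].
case/andP=> /andP[l1 l2] ps /and3P[/and3P[Bq qa qb] Iq2 Is].
case: (IH q2 ps) => [|s' [ss' so al al2]]; first by rewrite /= Iq2.
move: Iq2 => /and3P[Bq2 q2a q2b].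
case: (birth_between Bq Bq2 l1 l2) => [|x [y [B lx ly]]]; first lia.
exists ((x, y) :: s'); split => /=; first by rewrite ss'.
- case: s' so al2 {ss' al} => //= p s' -> /andP[lp _].
  by rewrite /goes_se /=; lia.
- by rewrite al andbT /inrect B /=; lia.
apply/andP; split; first lia.
by apply: sub_all al2 => p; lia.
Qed.

Lemma chain_up r a b q s : a + b + 2 <= N -> path goes_se q s -> all (inrect r.+1 a b) (q :: s) ->
  exists s', [/\ size s' = (size s).+1, sorted goes_se s', all (inrect r a b) s' &
              all (fun p => (q.1 <= p.1) && (p.2 < q.2)) s'].
Proof.
move=> lc; elim: s q => [|q2 s IH] q /=.
  rewrite andbT => _ /and3P[Bq qa qb]; move: (Bq) => /and5P[lq /eqP hq _ _ _].
  have [|||z lz bz] := @birth_in_col _ _ _ _ G r q.1 0 q.2; try lia.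
    by case: (G) => -> //; lia.
  by exists [:: (q.1, z)]; split => //=; rewrite /inrect /= ?bz; lia.
case/andP=> /andP[l1 l2] ps /and3P[/and3P[Bq qa qb] Iq2 Is].
case: (IH q2 ps) => [|s' [ss' so al al2]]; first by rewrite /= Iq2.
move: Iq2 => /and3P[Bq2 q2a q2b].
case: (birth_between_prev Bq Bq2 l1 l2) => x [y [B lx ly]].
exists ((x, y) :: s'); split => /=; first by rewrite ss'.
- case: s' so al2 {ss' al} => //= p s' -> /andP[lp _].
  by rewrite /goes_se /=; lia.
- by rewrite al andbT /inrect B /=; lia.
apply/andP; split; first lia.
by apply: sub_all al2 => p; lia.
Qed.

Lemma chain_grow r a b s : a + b + 2 <= N -> 0 < size s ->
  sorted goes_se s -> all (inrect r.+1 a b) s ->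
  exists s', [/\ size s' = (size s).+1, sorted goes_se s' & all (inrect r a b) s'].
Proof.
case: s => // q s lc _ /= ps al.
case: (chain_up lc ps al) => s' [ss' so al' al2].
move: al => /= /andP[/and3P[Bq qa qb] _]; move: (Bq) => /and5P[lq _ /eqP vq _ _].
have [|||z lz bz] := @birth_in_row r 0 q.1 q.2; try lia.
  by case: (G) => _ -> //; lia.
exists ((z, q.2) :: s'); split => /=; first by rewrite ss'.
- case: s' so al2 {ss' al'} => //= p s' -> /andP[lp _].
  by rewrite /goes_se /=; lia.
- by rewrite al' andbT /inrect bz /=; lia.
Qed.

Lemma chain_birth k r a b s : a + b + 2 <= N -> size s = k.+1 ->
  sorted goes_se s -> all (inrect r a b) s -> exists x y, inrect (r + k) a b (x, y).
Proof.
move=> lc; elim: k r s => [|k IH] r [|q s] //= [ss].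
  by rewrite addn0 => _ /andP[Iq _]; exists q.1, q.2; rewrite -surjective_pairing.
move=> ps al; case: (chain_down lc ps al) => s' [ss' so al' _].
by rewrite -addSnnS; apply: IH al' => //; rewrite ss'.
Qed.

Lemma birth_chain k r a b x y : a + b + 2 <= N -> inrect (r + k) a b (x, y) ->
  exists s, [/\ size s = k.+1, sorted goes_se s & all (inrect r a b) s].
Proof.
move=> lc I.
suff H j : j <= k -> exists s, [/\ size s = j.+1, sorted goes_se s &
  all (inrect (r + (k - j)) a b) s].
  by case: (H k (leqnn k)) => s; rewrite subnn addn0; exists s.
elim: j => [|j IH] lj; first by exists [:: (x, y)]; rewrite subn0 /= I.
case: IH => [|s [ss so al]]; first lia.
have e : r + (k - j) = (r + (k - j.+1)).+1 by lia.
rewrite e in al.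
by case: (chain_grow lc _ so al) => [|s' [ss' so' al']]; rewrite ?ss //; exists s'; rewrite ss' ss.
Qed.

(** Decreasing chains of k + 1 dots shrink, one point per level, to a single
birth of the label k + 1, and conversely.  This is the part of Greene's theorem
that concerns the number of rows. *)
Lemma dec_chainP k : reflect
  (exists a b s, [/\ a + b + 2 <= N, size s = k.+1, sorted goes_se s &
       all (fun p => [&& X p.1 p.2, p.1 <= a & p.2 <= b]) s])
  [exists x : 'I_N, k < h x (N - x.+1)].
Proof.
apply: (iffP existsP) => [[x lt]|[a [b [s [lc ss so al]]]]].
  have ltx : x < N := ltn_ord x.
  have [|||z lz B] := @birth_in_col _ _ _ _ G k x 0 (N - x.+1); try lia.
    by case: (G) => -> //; lia.
  have lc : x + z + 2 <= N by lia.
  (* The birth itself is the corner of the rectangle that contains the chain. *)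
  have [|s [ss so al]] := @birth_chain k 0 x z x z lc.
    by rewrite /inrect B !leqnn.
  exists x, z, s; split => //; apply: sub_all al => p /and3P[B' -> ->].
  by rewrite -(birth0 G) ?B' //; case/andP: B'.
have al' : all (inrect 0 a b) s.
  by apply: sub_all al => p /and3P[Xp pa pb]; rewrite /inrect pa pb (birth0 G) ?Xp //; lia.
have [x [y /and3P[/= /and5P[l _ _ /eqP e _] xa yb]]] := chain_birth lc ss so al'.
have ltx : x < N by lia.
exists (Ordinal ltx) => /=.
by have := @h_mono _ _ _ _ G x y.+1 (N - x.+1) ltac:(lia) ltac:(lia); lia.
Qed.

End Chains.

(** * Rows of the partitions and increasing chains *)

Section Shapes.
Variables (N : nat) (X : nat -> nat -> bool) (h v : nat -> nat -> nat).
Hypothesis G : growth N X h v.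

Lemma dot_labels x y : x + y + 2 <= N -> X x y ->
  [/\ h x y = 0, v x y = 0, h x y.+1 = 1 & v x.+1 y = 1].
Proof.
move=> lc Xxy; case: (cell_cases G lc) => [][]; last by rewrite Xxy.
by case: G => _ _ /(_ _ _ lc)[_ _ /(_ Xxy)[-> ->]] _ -> ->.
Qed.

(** The order of the two labels is decided by the lower of the two dots, and the
local rule applied to the two adjacent cells of each later row preserves it. *)
Lemma asc_label x y f g : X x f -> X x.+1 g -> x + y + 1 < N -> f < y -> g < y ->
  f != g -> (f < g) = (h x.+1 y <= h x y).
Proof.
move=> Xf Xg ly fy gy ne.
have [|hf _ hf1 _] := @dot_labels x f _ Xf; first lia.
have [|hg _ hg1 _] := @dot_labels x.+1 g _ Xg; first lia.
case: (ltngtP f g) ne => // [fg|gf] _.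
- have ge : h x.+1 f.+1 <= h x.+1 g by apply: (h_mono G); lia.
  suff : 0 < h x y /\ h x.+1 y <= h x y by case=> _ ->.
  elim: y ly fy {gy} => // y IH ly fy.
  move: (fy); rewrite ltnS leq_eqVlt => /predU1P[<-|fy']; first lia.
  have [||l1 l2] := IH; try lia.
  have lc1 : x + y + 2 <= N by lia.
  have lc2 : x.+1 + y + 2 <= N by lia.
  have nX : ~~ X x y by apply/negP => Xy; case: (dot_labels lc1 Xy); lia.
  by case: (cell_cases G lc1); case: (cell_cases G lc2) => [][? ? ? ?][]; lia.
- have ge : h x g.+1 <= h x f by apply: (h_mono G); lia.
  suff : h x y < h x.+1 y by lia.
  elim: y ly {fy} gy => // y IH ly fy.
  move: (fy); rewrite ltnS leq_eqVlt => /predU1P[<-|fy']; first lia.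
  have l1 : h x y < h x.+1 y by apply: IH; lia.
  have lc1 : x + y + 2 <= N by lia.
  have lc2 : x.+1 + y + 2 <= N by lia.
  by case: (cell_cases G lc1); case: (cell_cases G lc2) => [][? ? ? ?][]; lia.
Qed.

(** Row r of the partition at the grid point (x, y).  For r = 0 the sum counts
the unlabelled edges. *)
Definition rowlen r x y := \sum_(i < x) (h i y == r).

Lemma rowlenS r x y : rowlen r x.+1 y = rowlen r x y + (h x y == r).
Proof. by rewrite /rowlen big_ord_recr. Qed.

Lemma rowlen0 r x : 0 < r -> x <= N -> rowlen r x 0 = 0.
Proof.
move=> r0 lx; rewrite /rowlen big1 // => i _.
have li : i < x := ltn_ord i.
case: (G) => h0 _ _; rewrite h0; last lia.
by case: r r0.
Qed.

(** The labels of the vertical edges describe the same partitions, so the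
definition does not depend on the path from the axes to (x, y). *)
Lemma rowlen_v r x y : 0 < r -> x + y < N -> rowlen r x y.+1 = rowlen r x y + (v x y == r).
Proof.
move=> r0; elim: x => [|x IH] lt.
  by rewrite /rowlen !big_ord0; case: (G) => _ v0 _; rewrite v0 //; case: r r0.
have lc : x + y + 2 <= N by lia.
rewrite !rowlenS IH; last lia.
by case: (cell_cases G lc) => [][]; lia.
Qed.

Lemma rowlen_vsum r x y : 0 < r -> x + y <= N -> rowlen r x y = \sum_(j < y) (v x j == r).
Proof.
move=> r0; elim: y => [|y IH] lt; first by rewrite big_ord0 rowlen0; lia.
by rewrite rowlen_v // ?big_ord_recr /= ?IH //; lia.
Qed.

Lemma rowlen_part r x y : 0 < r -> x + y <= N -> rowlen r.+1 x y <= rowlen r x y.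
Proof.
have [m] := ubnP (x + y); elim: m x y r => // m IH [|x] [|y] r lm r0 lt.
- by rewrite /rowlen !big_ord0.
- by rewrite /rowlen !big_ord0.
- by rewrite rowlen0 //; lia.
have lc : x + y + 2 <= N by lia.
have := IH x y r ltac:(lia) r0 ltac:(lia).
have := IH x.+1 y r ltac:(lia) r0 ltac:(lia).
have := IH x y.+1 r ltac:(lia) r0 ltac:(lia).
rewrite !rowlenS !rowlen_v //; try lia.
by case: (cell_cases G lc) => [][]; lia.
Qed.

Lemma rowlen_monox r x x' y : x <= x' -> rowlen r x y <= rowlen r x' y.
Proof.
by elim: x' => [|x' IH]; rewrite leq_eqVlt => /predU1P[->//|//]; rewrite ltnS rowlenS => /IH; lia.
Qed.

Lemma rowlen_monoy r x y y' : 0 < r -> y <= y' -> x + y' <= N -> rowlen r x y <= rowlen r x y'.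
Proof.
move=> r0; elim: y' => [|y' IH]; rewrite leq_eqVlt => /predU1P[->//|//].
rewrite ltnS => le lt; rewrite rowlen_v //; last lia.
by have := IH le; lia.
Qed.

Lemma rowlen_le r x y : rowlen r x y <= x.
Proof.
elim: x => [|x IH]; first by rewrite /rowlen big_ord0.
by rewrite rowlenS; lia.
Qed.

Definition goes_sw (p q : nat * nat) := (q.1 < p.1) && (q.2 < p.2).
Definition dot_below x y (p : nat * nat) := [&& X p.1 p.2, p.1 < x & p.2 < y].

Lemma inc_chain_le s x y : x + y <= N -> sorted goes_sw s -> all (dot_below x y) s ->
  size s <= rowlen 1 x y.
Proof.
elim: s x y => [|p s IH] x y lt //= ps /andP[/and3P[Xp px py] al].
have lc : p.1 + p.2 + 2 <= N by lia.
have [e1 e2 e3 e4] := dot_labels lc Xp.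
have tr : transitive goes_sw by move=> a b c; rewrite /goes_sw; lia.
have mn := order_path_min tr ps.
have le : size s <= rowlen 1 p.1 p.2.
  apply: IH; [lia | exact: path_sorted ps |].
  apply/allP => q qs; move/allP/(_ _ qs): mn => mn; move/allP/(_ _ qs): al => /and3P[Xq _ _].
  by rewrite /dot_below Xq.
apply: (@leq_trans (rowlen 1 p.1.+1 p.2.+1)).
  by rewrite rowlenS rowlen_v // ?e3 ?e2 /=; lia.
apply: leq_trans (rowlen_monox _ _ px) _.
by apply: rowlen_monoy => //; lia.
Qed.

(** Outside the dots the first row obeys the rule of a maximum, as the length of
a longest chain does: only labels 1 change it, and two lines labelled 1 that
meet both leave with label 2. *)
Lemma inc_chain_ex x y : x + y <= N -> 
  exists s, [/\ size s = rowlen 1 x y, sorted goes_sw s & all (dot_below x y) s].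
Proof.
have [m] := ubnP (x + y); elim: m x y => // m IH [|x] [|y] lm lt.
- by exists [::]; rewrite /rowlen big_ord0.
- by exists [::]; rewrite /rowlen big_ord0.
- by exists [::]; rewrite rowlen0 //; lia.
have lc : x + y + 2 <= N by lia.
have wk x' y' : x' <= x.+1 -> y' <= y.+1 -> subpred (dot_below x' y') (dot_below x.+1 y.+1).
  by move=> lx ly p /and3P[Xp px py]; rewrite /dot_below Xp; lia.
case: (boolP (X x y)) => [Xxy|nX].
  have [e1 e2 e3 e4] := dot_labels lc Xxy.
  have [||s [ss so al]] := IH x y; try lia.
  exists ((x, y) :: s); split => /=.
  - by rewrite ss rowlenS rowlen_v // ?e3 ?e2 /=; lia.
  - by case: s so al {ss} => //= p s -> /andP[/and3P[_ px py] _]; rewrite /goes_sw /= px py.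
  by apply/andP; split; [rewrite /dot_below Xxy /= !ltnS !leqnn | apply: sub_all al; apply: wk].
have : rowlen 1 x.+1 y.+1 = rowlen 1 x y.+1 \/ rowlen 1 x.+1 y.+1 = rowlen 1 x.+1 y.
  rewrite !rowlenS !rowlen_v //; try lia.
  by case: (cell_cases G lc) => [][]; lia.
case=> ->.
- have [||s [ss so al]] := IH x y.+1; try lia.
  by exists s; split => //; apply: sub_all al; apply: wk.
- have [||s [ss so al]] := IH x.+1 y; try lia.
  by exists s; split => //; apply: sub_all al; apply: wk.
Qed.

Lemma inc_chainP k : (forall x y, X x y -> x + y + 2 <= N) -> reflect
  (exists s, [/\ size s = k.+1, sorted goes_sw s & all (fun p => X p.1 p.2) s])
  [exists t : 'I_N.+1, k < rowlen 1 t (N - t)].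
Proof.
move=> inX; apply: (iffP existsP) => [[t lt]|[[|p s] [ss so al]]] //.
  have ltt : t < N.+1 := ltn_ord t.
  have [|s [ss so al]] := @inc_chain_ex t (N - t); first lia.
  exists (drop (size s - k.+1) s); split; first by rewrite size_drop; lia.
  - by apply: drop_sorted.
  apply/allP => p /mem_drop ps; by case/and3P: (allP al _ ps).
have Xp : X p.1 p.2 by case/andP: al.
have lc := inX _ _ Xp.
have lt : p.1.+1 < N.+1 by lia.
exists (Ordinal lt) => /=.
apply: (@leq_trans (rowlen 1 p.1.+1 p.2.+1)); last by apply: rowlen_monoy; lia.
have := @inc_chain_le (p :: s) p.1.+1 p.2.+1; rewrite ss; apply; first lia.
  exact: so.
apply/andP; split; first by rewrite /dot_below Xp !ltnS !leqnn.
have tr : transitive goes_sw by move=> a b c; rewrite /goes_sw; lia.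
have mn := order_path_min tr so.
apply/allP => q qs; move/allP/(_ _ qs): mn => /andP[q1 q2].
by move: al => /= /andP[_ /allP/(_ _ qs)] Xq; rewrite /dot_below Xq; lia.
Qed.
End Shapes.

Lemma growth_sym N X h v : growth N X h v -> (forall x y, X x y = X y x) ->
  forall x y, x + y < N -> h x y = v y x.
Proof.
move=> G sX x y lt.
by have [|-> _] := growth_det G (growth_tr G) _ lt.
Qed.

Lemma rowlen_sym N X h v : growth N X h v -> (forall x y, X x y = X y x) ->
  forall r x y, 0 < r -> x + y <= N -> rowlen h r x y = rowlen h r y x.
Proof.
move=> G sX r x y r0 lt; rewrite (rowlen_vsum G) //; apply: eq_bigr => j _.
by have ltj := ltn_ord j; rewrite (growth_sym G sX) //; lia.
Qed.

(** * Reconstructing a filling from its boundary *)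

(** The path that alternates between the points (x, d.+1 - x) and (x, d - x),
from the vertical to the horizontal axis.  The vertical step at x has label
[b x], the horizontal one label [a x]; [P] and [Q] are the partitions met at the
points of level d + 1 and of level d. *)
Definition zigzag d (a b : nat -> nat) := exists P Q : nat -> nat -> nat,
  [/\ forall r, 0 < r -> P 0 r = 0 /\ P d.+1 r = 0,
      forall x r, x <= d -> 0 < r -> P x r = Q x r + (b x == r) /\ P x.+1 r = Q x r + (a x == r),
      forall x r, x <= d.+1 -> 0 < r -> P x r.+1 <= P x r &
      forall x r, x <= d -> 0 < r -> Q x r.+1 <= Q x r].

Definition shrink (t r : nat) := if t == r then t.-1 else t.

Lemma grow_shrink t r : grow (shrink t r) (shrink r t) ((t == 1) && (r == 1)) = t.
Proof.
rewrite /grow /shrink (eq_sym r t); case: (eqVneq t r) => [<-|ne].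
  by rewrite eqxx; case: t => [|[]].
by rewrite (negPf ne).
Qed.

(** The points of level d + 1 are shared by the two zigzags, so the old [Q] is
the new [P]; new partitions arise by the inverse local rule below each cell of
level d. *)
Lemma zigzag_down d a b : zigzag d.+1 a b ->
  zigzag d (fun x => shrink (a x) (b x.+1)) (fun x => shrink (b x.+1) (a x)).
Proof.
case=> P [Q [P0 PQ pP pQ]].
exists Q, (fun x r => Q x r - (shrink (b x.+1) (a x) == r)); split.
- move=> r r0; case: (P0 r r0) => p0 p1.
  by case: (PQ 0 r _ r0) => //; case: (PQ d.+1 r _ r0) => //; lia.
- move=> x r lx r0.
  case: (PQ x r _ r0) => [|_ e1]; first lia.
  case: (PQ x.+1 r _ r0) => [|e2 _]; first lia.
  rewrite /shrink.
  case: (eqVneq (a x) (b x.+1)) => [e|ne]; last first.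
    by lia.
  rewrite e; case: (eqVneq (b x.+1).-1 r) => [e'|]; last lia.
  (* Two labels r + 1 > 1 come from two labels r; row r of the lower partition
     is not empty because it was longer than row r + 1. *)
  have et : b x.+1 = r.+1 by lia.
  have := pP x.+1 r ltac:(lia) r0.
  by case: (PQ x r.+1 ltac:(lia) isT); lia.
- by move=> x r lx r0; apply: pQ => //; lia.
- move=> x r lx r0.
  case: (PQ x r _ r0) => [|_ e1]; first lia.
  case: (PQ x.+1 r _ r0) => [|e2 _]; first lia.
  case: (PQ x r.+1 _ isT) => [|_ e3]; first lia.
  case: (PQ x.+1 r.+1 _ isT) => [|e4 _]; first lia.
  have := pQ x r ltac:(lia) r0; have := pQ x.+1 r ltac:(lia) r0; have := pP x.+1 r ltac:(lia) r0.
  rewrite /shrink; case: ifP => ?; lia.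
Qed.

Lemma zigzag_growth d a b : zigzag d a b -> exists X h v, growth d.+1 X h v /\
  forall x, x <= d -> h x (d - x) = a x /\ v x (d - x) = b x.
Proof.
elim: d a b => [|d IH] a b Z.
  exists (fun _ _ => false), (fun x _ => a x), (fun x _ => b x); split=> //.
  have [a0 b0] : a 0 = 0 /\ b 0 = 0.
    case: Z => P [Q [P0 PQ _ _]]; split; apply/eqP; rewrite -leqn0 leqNgt; apply/negP => lt.
    - by case: (P0 _ lt); case: (PQ 0 _ isT lt); lia.
    - by case: (P0 _ lt); case: (PQ 0 _ isT lt); lia.
  by split; [case=> // | case => // | move=> x y; lia].
have [X [h [v [G B]]]] := IH _ _ (zigzag_down Z).
exists (fun x y => if x + y == d then (a x == 1) && (b x.+1 == 1) else X x y),
       (fun x y => if x + y == d.+1 then a x else h x y),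
       (fun x y => if x + y == d.+1 then b x else v x y); split; last first.
  by move=> x lx; rewrite subnKC // eqxx.
case: G => h0 v0 G; split.
- move=> x lx; rewrite addn0; case: eqP => [->|ne]; last by apply: h0; lia.
  case: Z => P [Q [P0 PQ _ _]]; apply/eqP; rewrite -leqn0 leqNgt; apply/negP => lt.
  by case: (P0 _ lt); case: (PQ d.+1 _ (leqnn _) lt); lia.
- move=> y ly; rewrite add0n; case: eqP => [e|ne]; last by apply: v0; lia.
  case: Z => P [Q [P0 PQ _ _]]; apply/eqP; rewrite -leqn0 leqNgt; apply/negP => lt.
  by case: (P0 _ lt); case: (PQ 0 _ isT lt); lia.
move=> x y lc; case: (eqVneq (x + y) d) => [e|ne].
  have -> : (x + y.+1 == d.+1) = true by lia.
  have -> : (x.+1 + y == d.+1) = true by lia.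
  have -> : (x + y == d.+1) = false by lia.
  case: (B x _) => [|eh ev]; first lia.
  have ey : d - x = y by lia.
  rewrite ey in eh ev; rewrite eh ev grow_shrink andbC grow_shrink; split => //.
  by rewrite /shrink => /andP[/eqP -> /eqP ->].
have -> : (x + y.+1 == d.+1) = false by lia.
have -> : (x.+1 + y == d.+1) = false by lia.
have -> : (x + y == d.+1) = false by lia.
by apply: G; lia.
Qed.

(** * Words with a prescribed ascent pattern *)

Section WordSums.
Local Open Scope ring_scope.

Section Words.
Variables (R : pzRingType) (I : finType) (x : I -> R) (A : rel I).

(** Sums of noncommutative monomials over words.  In [wsum p] the adjacent
letters of the words satisfy [A] exactly where [p] is true.  [wtail p s] sums
over what follows a letter s, [whead p s] over the words that end with s, for
the pattern [p] read from right to left. *)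
Fixpoint wtail (p : seq bool) s : R :=
  if p is c :: p' then \sum_(s' | A s s' == c) x s' * wtail p' s' else 1.
Definition wsum p := \sum_s x s * wtail p s.
Fixpoint whead (p : seq bool) s : R :=
  if p is c :: p' then (\sum_(s' | A s' s == c) whead p' s') * x s else x s.

Lemma wcut p q : \sum_s whead p s * wtail q s = \sum_s whead (catrev q p) s.
Proof.
elim: q p => [|c q IH] p /=; first by apply: eq_bigr => s _; rewrite mulr1.
rewrite -IH /=; under eq_bigr do rewrite mulr_sumr.
under [RHS]eq_bigr do rewrite -mulrA mulr_suml.
rewrite (exchange_big_dep xpredT) //=; exact: eq_bigr.
Qed.

Lemma wsum_head p : wsum p = \sum_s whead (rev p) s.
Proof. exact: wcut [::] p. Qed.

Lemma wsum_cut p q : wsum (p ++ q) = \sum_s whead (rev p) s * wtail q s.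
Proof. by rewrite wcut wsum_head rev_cat catrevE. Qed.

(** At the junction of two concatenated words [A] holds or fails. *)
Lemma wsum_mul p q : wsum p * wsum q = wsum (p ++ true :: q) + wsum (p ++ false :: q).
Proof.
rewrite !wsum_cut -big_split wsum_head mulr_suml /=; apply: eq_bigr => s _.
rewrite -mulrDr /wsum; congr (_ * _).
rewrite (bigID (fun s' => A s s' == true)) /=; congr (_ + _).
by apply: eq_bigl => s'; case: (A s s').
Qed.

Hypothesis wcomm : forall a b, GRing.comm (wsum (nseq a true)) (wsum (nseq b true)).

(** The first descent of a pattern, the place where [wsum_mul] is applied. *)
Lemma split_false (q : seq bool) : q = nseq (size q) true \/
  exists b q', q = nseq b true ++ false :: q'.
Proof.
elim: q => [|[] q]; [by left | | by right; exists 0%N, q].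
case=> [e|[b [q' e]]]; [by left; rewrite /= -e | by right; exists b.+1, q'; rewrite e].
Qed.

Lemma wsum_comm a q : GRing.comm (wsum (nseq a true)) (wsum q).
Proof.
have [m] := ubnP (count negb q); elim: m q => // m IH q.
case: (split_false q) => [->|[b [q' ->]]] // lm.
have -> : wsum (nseq b true ++ false :: q') =
  wsum (nseq b true) * wsum q' - wsum (nseq b true ++ true :: q').
  by rewrite wsum_mul addrC addKr.
move: lm; rewrite count_cat /= => lm.
apply: commrB; first apply: commrM => //; apply: IH; last rewrite count_cat /=; lia.
Qed.

(** Removing the descents one by one with [wsum_mul] writes [wsum q] as a
polynomial in the sums over ascending words.  Reversing q reverses the order of
the factors of each monomial, and the factors commute. *)
Lemma wsum_rev q : wsum (rev q) = wsum q.
Proof.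
have [m] := ubnP (count negb q); elim: m q => // m IH q.
case: (split_false q) => [->|[b [q' ->]]] // lm.
  by rewrite rev_nseq.
have E c : wsum (nseq b true ++ c :: q') =
  wsum (nseq b true) * wsum q' - wsum (nseq b true ++ ~~ c :: q').
  by rewrite wsum_mul; case: c; [rewrite addrK | rewrite addrC addKr].
have E' c : wsum (rev q' ++ c :: nseq b true) =
  wsum (rev q') * wsum (nseq b true) - wsum (rev q' ++ ~~ c :: nseq b true).
  by rewrite wsum_mul; case: c; [rewrite addrK | rewrite addrC addKr].
have rv c : rev (nseq b true ++ c :: q') = rev q' ++ c :: nseq b true.
  by rewrite rev_cat rev_cons rev_nseq cat_rcons.
move: lm; rewrite count_cat /= => lm.
rewrite rv E' E -!rv !IH ?wsum_comm //=; try rewrite count_cat /=; lia.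
Qed.
End Words.

Lemma wsum_anti (R S : pzRingType) (I : finType) (f : {additive R -> S}) (x : I ->
  R) (A : rel I) p :
  f 1 = 1 -> (forall a b, f (a * b) = f b * f a) ->
  f (wsum x A p) = wsum (f \o x) (fun s s' => A s' s) (rev p).
Proof.
move=> f1 fM; rewrite [RHS]wsum_head revK /wsum raddf_sum; apply: eq_bigr => s _.
elim: p s => [|c p IH] s /=; first by rewrite mulr1.
by rewrite fM raddf_sum; congr (_ * _); apply: eq_bigr => s' _; exact: IH.
Qed.

(** Only pairs of letters with a nonzero product matter. *)
Lemma wsum_neg (R : pzRingType) (I : finType) (x : I -> R) (A A' : rel I) p :
  (forall s s', x s * x s' != 0 -> A s s' = ~~ A' s s') ->
  wsum x A p = wsum x A' (map negb p).
Proof.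
move=> H; apply: eq_bigr => s _.
elim: p s => [|c p IH] s //=; rewrite !mulr_sumr.
rewrite big_mkcond [RHS]big_mkcond; apply: eq_bigr => s' _.
rewrite -IH mulrA.
case: (eqVneq (x s * x s') 0) => [->|ne]; first by rewrite mul0r; do 2 case: ifP.
by rewrite (H _ _ ne); case: (A' s s'); case: c.
Qed.

Lemma wsum_row (R : pzRingType) (I J : finType) (x : I * J -> R) (A : rel I) p :
  wsum x (fun b b' => A b.1 b'.1) p = wsum (fun i => \sum_j x (i, j)) A p.
Proof.
have T : forall b, wtail x (fun b b' => A b.1 b'.1) p b = wtail (fun i => \sum_j x (i, j)) A p b.1.
  elim: p => [|c p IH] b //=; symmetry.
  under eq_bigr do rewrite mulr_suml.
  by rewrite pair_big /=; apply: eq_big => [[i j]|[i j] _] //=; rewrite ?andbT ?IH.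
rewrite /wsum; symmetry; under eq_bigr do rewrite mulr_suml.
by rewrite pair_big /=; apply: eq_big => [[i j]|[i j] _] //=; rewrite T.
Qed.
End WordSums.

(** * Partitions in a box *)

Section Shape.
Variables R C : nat.

Definition noninc (f : {ffun 'I_R -> 'I_C.+1}) :=
  [forall i : 'I_R, forall j : 'I_R, (i <= j) ==> (f j <= f i)].
Definition bpart := {f : {ffun 'I_R -> 'I_C.+1} | noninc f}.

(** Rows are counted from 0 and extended by 0 beyond R, so that partitions can
be compared through functions on all natural numbers. *)
Definition prow (mu : bpart) (i : nat) : nat := oapp (fun j : 'I_R => val mu j : nat) 0 (insub i).

Lemma prow_ord (mu : bpart) (i : 'I_R) : prow mu i = val mu i.
Proof. by rewrite /prow valK. Qed.

Lemma prow_le mu i : prow mu i <= C.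
Proof. by rewrite /prow; case: insub => //= j; rewrite -ltnS ltn_ord. Qed.

Lemma prow_out mu i : R <= i -> prow mu i = 0.
Proof. by move=> le; rewrite /prow insubF //; lia. Qed.

Lemma prow_mono mu i j : i <= j -> prow mu j <= prow mu i.
Proof.
move=> le; case: (leqP R j) => [Rj|jR]; first by rewrite prow_out.
have iR := leq_ltn_trans le jR.
rewrite -[j]/(val (Ordinal jR)) -[i]/(val (Ordinal iR)) !prow_ord.
by move/forallP/(_ (Ordinal iR))/forallP/(_ (Ordinal jR))/implyP: (valP mu); apply.
Qed.

Lemma prow_inj mu nu : (forall i, prow mu i = prow nu i) -> mu = nu.
Proof.
by move=> e; apply/val_inj/ffunP => i; apply/val_inj; rewrite /= -!prow_ord.
Qed.

Lemma bpart0_subproof : noninc [ffun=> ord0].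
Proof. by apply/forallP => i; apply/forallP => j; rewrite !ffunE leqnn implybT. Qed.

Definition bpart0 : bpart := exist (fun f => is_true (noninc f)) _ bpart0_subproof.

Lemma prow0 i : prow bpart0 i = 0.
Proof. by rewrite /prow; case: insub => //= j; rewrite ffunE. Qed.

Definition mk_bpart (f : nat -> nat) : bpart := insubd bpart0 [ffun i : 'I_R => inord (f i)].

Definition bounded_rows f := [/\ forall i j, i <= j ->
  f j <= f i, forall i, f i <= C & forall i, R <= i -> f i = 0].

Lemma mk_bpartE f : bounded_rows f -> forall i, prow (mk_bpart f) i = f i.
Proof.
case=> fm fC f0 i; case: (leqP R i) => [Ri|iR]; first by rewrite prow_out // f0.
rewrite -[i]/(val (Ordinal iR)) prow_ord /mk_bpart val_insubd.
case: ifP => [_|/negbT/negP[]]; first by rewrite ffunE inordK // ltnS.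
by apply/forallP => a; apply/forallP => b; apply/implyP => /fm; rewrite !ffunE !inordK // ltnS.
Qed.

Definition psize mu := \sum_(i < R) prow mu i.

Definition covers r mu nu := (r < R) && [forall i : 'I_R, prow nu i == prow mu i + (i == r :> nat)].

Lemma coversP r mu nu : reflect (r < R /\ forall i, prow nu i =
  prow mu i + (i == r)) (covers r mu nu).
Proof.
apply: (iffP andP) => [[rR /forallP H]|[rR H]]; split => //.
  move=> i; case: (leqP R i) => [Ri|iR]; first by rewrite !prow_out //; lia.
  by move/eqP: (H (Ordinal iR)).
by apply/forallP => i; apply/eqP.
Qed.

Lemma psize_covers r mu nu : covers r mu nu -> psize nu = (psize mu).+1.
Proof.
case/coversP=> rR H; rewrite /psize (bigD1 (Ordinal rR)) // [in RHS](bigD1 (Ordinal rR)) //=.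
rewrite H eqxx addn1 addSn; congr (_.+1 + _).
by apply: eq_bigr => i; rewrite -val_eqE /= H => /negPf ->; rewrite addn0.
Qed.

Definition strip mu nu :=
  [forall i : 'I_R, prow mu i <= prow nu i] && [forall i : 'I_R, prow nu i.+1 <= prow mu i].

Lemma stripP mu nu : reflect (forall i, prow mu i <= prow nu i /\
  prow nu i.+1 <= prow mu i) (strip mu nu).
Proof.
apply: (iffP andP) => [[/forallP H1 /forallP H2] i|H].
  case: (leqP R i) => [Ri|iR]; first by rewrite !prow_out //; lia.
  by split; [apply: (H1 (Ordinal iR)) | apply: (H2 (Ordinal iR))].
by split; apply/forallP => i; case: (H i).
Qed.

(** The bound s on the rows serves the induction on a: the boxes are added from
the lowest row upwards, so those still to be added lie in the row of the last
one or above it. *)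
Definition hstrip a s mu nu :=
  [&& strip mu nu, psize nu == psize mu + a &
      [forall i : 'I_R, (s <= i) ==> (prow nu i == prow mu i)]].

Lemma hstripP a s mu nu : reflect
  [/\ strip mu nu, psize nu = psize mu + a & forall i, s <= i -> prow nu i = prow mu i]
  (hstrip a s mu nu).
Proof.
apply: (iffP and3P) => [[st /eqP e /forallP H]|[st e H]]; split => //; last 2 first.
- by apply/eqP.
- by apply/forallP => i; apply/implyP => /H ->.
move=> i si; case: (leqP R i) => [Ri|iR]; first by rewrite !prow_out.
by move/implyP: (H (Ordinal iR)) => /(_ si)/eqP.
Qed.

Lemma psize_eq mu nu : (forall i, prow mu i <= prow nu i) -> psize nu = psize mu -> mu = nu.
Proof.
move=> le e; apply: prow_inj => i; case: (leqP R i) => [Ri|iR]; first by rewrite !prow_out.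
apply/eqP; rewrite eqn_leq le leqNgt /=; apply/negP => lt.
suff : psize mu < psize nu by rewrite e ltnn.
rewrite /psize (bigD1 (Ordinal iR)) // [in X in _ < X](bigD1 (Ordinal iR)) //=.
by rewrite -addSn leq_add // leq_sum.
Qed.

Lemma hstrip0 s mu nu : hstrip 0 s mu nu = (mu == nu).
Proof.
apply/hstripP/eqP => [[/stripP st e _]|->].
  by apply: psize_eq; [move=> i; case: (st i) | rewrite e addn0].
by split; rewrite ?addn0 //; apply/stripP => i; split => //; apply: prow_mono.
Qed.

Lemma covers_hstrip a s r mu rho nu : r < s -> covers r mu rho -> hstrip a r.+1 rho nu ->
  [/\ hstrip a.+1 s mu nu, prow mu r < prow nu r & forall i, r < i -> prow nu i = prow mu i].
Proof.
move=> rs cv /hstripP[/stripP st e H]; have e' := psize_covers cv; case/coversP: cv => rR E.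
have H' i : r < i -> prow nu i = prow mu i by move=> ri; rewrite H // E; lia.
split => //; last by case: (st r); rewrite E eqxx; lia.
apply/hstripP; split; [|lia|by move=> i si; apply: H'; lia].
apply/stripP => i; case: (st i); rewrite E => a1 a2; split; first lia.
case: (eqVneq i r) a2 => [->|] ; last lia.
by rewrite H' // => _; apply: prow_mono.
Qed.

(** The first box goes to the lowest row in which mu and nu differ. *)
Lemma hstrip_covers a s mu nu : hstrip a.+1 s mu nu ->
  exists r rho, [/\ r < s, covers r mu rho & hstrip a r.+1 rho nu].
Proof.
case/hstripP=> /stripP st e H.
have [i0 lt0] : exists i, prow mu i < prow nu i.
  case: (boolP [exists i : 'I_R, prow mu i < prow nu i]) => [/existsP[i ?]|]; first by exists i.
  rewrite negb_exists => /forallP A.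
  suff : psize nu <= psize mu by lia.
  by apply: leq_sum => i _; rewrite leqNgt.
have bd i : prow mu i < prow nu i -> i <= R.
  by case: (leqP R i) => [Ri|]; [rewrite !prow_out | lia].
case: (ex_maxnP (ex_intro (fun i => prow mu i < prow nu i) _ lt0) bd) => r ltr rmax.
have rs : r < s by case: (ltnP r s) => // /H; lia.
have rR : r < R by case: (ltnP r R) => // le; move: ltr; rewrite !prow_out.
have H' i : r < i -> prow nu i = prow mu i.
  by move=> ri; case: (st i) => le _; case: (ltnP (prow mu i) (prow nu i)) => [/rmax|]; lia.
have ft : bounded_rows (fun i => prow mu i + (i == r)).
  split=> [i j le|i|i le]; last by rewrite prow_out //; lia.
    have := prow_mono mu le; case: (eqVneq j r) => [ej|]; last lia.
    case: (eqVneq i r) => [|ne]; first lia.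
    have ee : i.+1 <= r by lia.
    by have := prow_mono nu ee; case: (st i); rewrite ej; lia.
  by have := prow_le nu i; case: (st i); case: (eqVneq i r) => [->|]; lia.
exists r, (mk_bpart (fun i => prow mu i + (i == r))).
have cv : covers r mu (mk_bpart (fun i => prow mu i + (i == r))) by apply/coversP;
  split=> // i; rewrite mk_bpartE.
split => //; apply/hstripP; split.
- apply/stripP => i; rewrite mk_bpartE //; case: (st i) => a1 a2; split; last lia.
  by case: (eqVneq i r) => [->|]; lia.
- by rewrite (psize_covers cv); lia.
- by move=> i ri; rewrite mk_bpartE // H' //; lia.
Qed.

(** ** The Bender-Knuth involution *)

(** If mu, rho and nu differ by horizontal strips, the rows of rho range
independently over the intervals from [bk_lo] to [bk_hi]; [bk] reflects each row
in its interval. *)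
Definition bk_lo (mu nu : bpart) i := maxn (prow mu i) (prow nu i.+1).
Definition bk_hi (mu nu : bpart) i := if i is j.+1 then minn (prow nu i) (prow mu j) else prow nu 0.
Definition bk mu nu rho := mk_bpart (fun i => bk_lo mu nu i + bk_hi mu nu i - prow rho i).

(** The upper bound of row i + 1 and the lower bound of row i are the minimum
and the maximum of the same two numbers, [prow nu i.+1] and [prow mu i]. *)
Lemma bk_sum mu nu m :
  \sum_(i < m) bk_lo mu nu i + \sum_(i < m.+1) bk_hi mu nu i =
  \sum_(i < m) prow mu i + \sum_(i < m.+1) prow nu i.
Proof.
elim: m => [|m IH]; first by rewrite !big_ord0 !big_ord1.
rewrite big_ord_recr [\sum_(i < m.+2) _]big_ord_recr /= [in RHS]big_ord_recr [\sum_(i < m.+2)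
  prow _ _]big_ord_recr /=.
have -> : bk_lo mu nu m = maxn (prow mu m) (prow nu m.+1) by [].
by rewrite addnACA IH [in RHS]addnACA; congr (_ + _); lia.
Qed.

Lemma bk_bounds mu nu rho : strip mu rho -> strip rho nu ->
  forall i, bk_lo mu nu i <= prow rho i <= bk_hi mu nu i.
Proof.
move=> /stripP s1 /stripP s2 i; rewrite /bk_lo geq_max /bk_hi.
case: i => [|i]; first by case: (s1 0) (s2 0); lia.
by case: (s1 i) (s2 i); case: (s1 i.+1) (s2 i.+1); lia.
Qed.

Lemma bk_fits mu nu rho : strip mu rho -> strip rho nu ->
  bounded_rows (fun i => bk_lo mu nu i + bk_hi mu nu i - prow rho i).
Proof.
move=> s1 s2; have B := bk_bounds s1 s2.
have B' i : bk_lo mu nu i <= bk_lo mu nu i + bk_hi mu nu i - prow rho i <= bk_hi mu nu i by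
  have := B i; lia.
have step i : bk_hi mu nu i.+1 <= bk_lo mu nu i by rewrite /bk_lo /bk_hi; lia.
split => [i j|i|i Ri].
- elim: j => [|j IH]; first by rewrite leqn0 => /eqP ->.
  rewrite leq_eqVlt => /predU1P[->//|lt].
  by have := IH lt; have := B' j; have := B' j.+1; have := step j; lia.
- apply: (@leq_trans (bk_hi mu nu i)); first by case/andP: (B' i).
  by case: i => [|i]; rewrite /bk_hi; [exact: prow_le | have := prow_le nu i.+1; lia].
- have h0 : bk_hi mu nu i = 0 by case: i Ri => [|i] Ri; rewrite /bk_hi prow_out //; lia.
  by have := B' i; rewrite h0; lia.
Qed.

Lemma bk_strip mu nu rho : strip mu rho -> strip rho nu ->
  strip mu (bk mu nu rho) /\ strip (bk mu nu rho) nu.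
Proof.
move=> s1 s2; have B := bk_bounds s1 s2; have F := bk_fits s1 s2.
have B' i : bk_lo mu nu i <= prow (bk mu nu rho) i <= bk_hi mu nu i by rewrite mk_bpartE //;
  have := B i; lia.
split; apply/stripP => i; have := B' i; have := B' i.+1;
  rewrite {1}/bk_lo {1}/bk_hi /bk_lo /bk_hi; case: i => [|i]; try lia.
Qed.

Lemma bkK mu nu rho : strip mu rho -> strip rho nu -> bk mu nu (bk mu nu rho) = rho.
Proof.
move=> s1 s2; have [s3 s4] := bk_strip s1 s2; apply: prow_inj => i.
rewrite mk_bpartE; last exact: bk_fits.
by rewrite mk_bpartE; [have := bk_bounds s1 s2 i; lia | exact: bk_fits].
Qed.

Lemma bk_sz mu nu rho : strip mu rho -> strip rho nu ->
  psize (bk mu nu rho) + psize rho = psize mu + psize nu.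
Proof.
move=> s1 s2; have := bk_sum mu nu R;
  rewrite [\sum_(i < R.+1) prow _ _]big_ord_recr /= prow_out // addn0.
rewrite big_ord_recr /=.
have le i : bk_hi mu nu i <= prow nu i by rewrite /bk_hi; case: i => // i; lia.
have -> : bk_hi mu nu R = 0 by move: (le R); rewrite prow_out //; lia.
rewrite addn0 -/(psize mu) -/(psize nu) => <-; rewrite /psize -!big_split /=; apply: eq_bigr => i _.
rewrite mk_bpartE; last exact: bk_fits.
by have := bk_bounds s1 s2 i; lia.
Qed.

(** The reflection exchanges the sizes of the two strips.  One inequality is
enough, as a and b are arbitrary. *)
Lemma bk_card a b mu nu :
  #|[set rho | hstrip a R mu rho && hstrip b R rho nu]| <=
  #|[set rho | hstrip b R mu rho && hstrip a R rho nu]|.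
Proof.
rewrite -(card_in_imset (f := bk mu nu)).
  apply/subset_leq_card/subsetP => _ /imsetP[rho + ->].
  rewrite !inE => /andP[/hstripP[s1 e1 _] /hstripP[s2 e2 _]].
  have [s3 s4] := bk_strip s1 s2; have es := bk_sz s1 s2.
  by apply/andP; split; apply/hstripP; split => //; try lia; move=> i Ri; rewrite !prow_out.
move=> r1 r2; rewrite !inE => /andP[/hstripP[s1 _ _] /hstripP[s2 _ _]].
case/andP=> /hstripP[s3 _ _] /hstripP[s4 _ _] e.
by rewrite -(bkK s1 s2) e bkK.
Qed.
End Shape.

(** * Conjugation and ascent patterns *)

Lemma sum_initial (P : nat -> bool) m r : (forall i j, i <= j -> P j -> P i) ->
  (r < \sum_(i < m) P i) = (r < m) && P r.
Proof.
move=> dP; elim: m => [|m IH]; first by rewrite big_ord0 !ltn0.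
rewrite big_ord_recr /=; case: (boolP (P m)) => Pm /=.
  have -> : \sum_(i < m) P i = m.
    rewrite -[RHS]card_ord -sum1_card; apply: eq_bigr => i _.
    by rewrite (dP i m) // ltnW.
  by rewrite addn1; case: (ltnP r m.+1) => //= lt; rewrite (dP r m).
rewrite addn0 IH ltnS [r <= m]leq_eqVlt; case: eqP => [->|//].
by rewrite ltnn (negPf Pm).
Qed.

Section Conj.
Variables R C : nat.
Definition conj_part (mu : bpart R C) : bpart C R :=
  mk_bpart C R (fun c => \sum_(r < R) (c < prow mu r)).

Lemma conj_partP mu r c : (r < prow (conj_part mu) c) = (c < prow mu r).
Proof.
have dP c' : forall i j, i <= j -> c' < prow mu j -> c' < prow mu i.
  by move=> i j le lt; apply: leq_trans lt (prow_mono mu le).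
have lnE c' r' : (r' < \sum_(r < R) (c' < prow mu r)) = (c' < prow mu r').
  rewrite (sum_initial (P := fun r => c' < prow mu r)) //; last exact: dP.
  by case: (ltnP r' R) => //= le; rewrite prow_out.
rewrite mk_bpartE ?lnE //; split=> [i j le|i|i le].
- rewrite leqNgt; apply/negP; rewrite lnE => lt.
  have : j < prow mu (\sum_(r < R) (i < prow mu r)) by [].
  by move/(leq_ltn_trans le); rewrite -lnE ltnn.
- rewrite -[X in _ <= X]card_ord -sum1_card; apply: leq_sum => j _; exact: leq_b1.
- by rewrite big1 // => j _; rewrite ltnNge (leq_trans (prow_le mu j) le).
Qed.
End Conj.

Lemma bpart_ext R C (mu nu : bpart R C) : (forall r c, (c < prow mu r) = (c < prow nu r)) ->
  mu = nu.
Proof.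
move=> H; apply: prow_inj => r; apply/eqP; rewrite eqn_leq; apply/andP.
by split; rewrite leqNgt ?H ?ltnn // -H ltnn.
Qed.

Lemma conj_partK R C : cancel (@conj_part R C) (@conj_part C R).
Proof. by move=> mu; apply: bpart_ext => r c; rewrite !conj_partP. Qed.

Lemma conj_part0 R C : conj_part (bpart0 R C) = bpart0 C R.
Proof. by apply: bpart_ext => r c; rewrite conj_partP !prow0. Qed.

(** The column of the new box is recorded so that conjugation just exchanges the
two coordinates. *)
Definition adds_box R C (b : 'I_R * 'I_C) (mu nu : bpart R C) :=
  covers b.1 mu nu && (prow mu b.1 == b.2).

Lemma adds_boxP R C (b : 'I_R * 'I_C) (mu nu : bpart R C) : reflect
  ((forall r c, (c < prow nu r) = (c < prow mu r) || ((r == b.1) && (c == b.2))) /\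
    ~~ (b.2 < prow mu b.1))
  (adds_box b mu nu).
Proof.
case: b => r0 c0 /=; rewrite /adds_box /=.
apply: (iffP andP) => [[/coversP[_ E] /eqP e]|[H n]].
  by split; [move=> r c; rewrite E; case: eqP => [->|] /=; lia | lia].
have e : prow mu r0 = c0.
  have lt : c0 < prow nu r0 by rewrite H !eqxx orbT.
  apply/eqP; rewrite eqn_leq leqNgt n /=.
  case: (posnP c0) => [-> //|c0p].
  by have := H r0 c0.-1; rewrite (leq_ltn_trans (leq_pred _) lt) eqxx /=; lia.
split; last by rewrite e.
apply/coversP; split; first exact: ltn_ord.
move=> r; apply/eqP; rewrite eqn_leq; apply/andP; split; rewrite leqNgt; apply/negP => lt.
- have := H r (prow mu r + (r == r0)); rewrite lt; case: eqP => [er|ner] /=; last lia.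
  by rewrite er e; lia.
- have := H r (prow nu r); rewrite ltnn; case: eqP lt => [er|ner] /=; last lia.
  by rewrite er e; lia.
Qed.

Definition bswap {I J : Type} (b : I * J) := (b.2, b.1).

Lemma adds_box_conj R C (b : 'I_R * 'I_C) (mu nu : bpart R C) :
  adds_box (bswap b) (conj_part mu) (conj_part nu) = adds_box b mu nu.
Proof.
apply/adds_boxP/adds_boxP => [[H n]|[H n]]; split.
- by move=> r c; rewrite -(conj_partP nu) -(conj_partP mu) H andbC.
- by rewrite -conj_partP.
- by move=> r c; rewrite !conj_partP H andbC.
- by rewrite conj_partP.
Qed.

(** When two boxes are added one after the other, the second is not lower than
the first iff it lies strictly to its right.  This is why conjugation exchanges
ascents and descents. *)
Lemma adds_box_pair R C (b b' : 'I_R * 'I_C) (mu nu xi : bpart R C) : adds_box b mu nu ->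
  adds_box b' nu xi ->
  (b'.1 <= b.1) = ~~ (b'.2 <= b.2).
Proof.
case/andP=> /coversP[_ E] /eqP e /andP[/coversP[_ E'] /eqP e'].
rewrite -ltnNge -e -e'; case: (leqP b'.1 b.1) => lt.
  by have := prow_mono nu lt; rewrite (E b.1) eqxx; lia.
have := prow_mono mu (ltnW lt); rewrite (E b'.1).
have -> : (b'.1 == b.1 :> nat) = false by lia.
lia.
Qed.

Section PatternMatrices.
Local Open Scope ring_scope.

Section Mx.
Variable T : finType.
(** Square matrices indexed by a finite type, used as the ring of operators on
partitions; [entry] reads them off. *)
Definition fun_mx (f : T -> T -> int) : 'M[int]_#|T| := \matrix_(i, j) f (enum_val i) (enum_val j).
Definition entry (A : 'M[int]_#|T|) a b : int := A (enum_rank a) (enum_rank b).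

Lemma entry_fun_mx f a b : entry (fun_mx f) a b = f a b.
Proof. by rewrite /entry mxE !enum_rankK. Qed.

Lemma entry_mul A B a b : entry (A * B) a b = \sum_c entry A a c * entry B c b.
Proof.
rewrite /entry -mulmxE mxE (reindex_onto (@enum_rank T) enum_val) /=; last by move=> i _;
  rewrite enum_valK.
by apply: eq_bigl => i; rewrite enum_rankK eqxx.
Qed.

Lemma entry_sum (I : finType) (P : pred I) F a b :
  entry (\sum_(i | P i) F i) a b = \sum_(i | P i) entry (F i) a b.
Proof. by rewrite /entry summxE. Qed.

Lemma entry1 a b : entry 1 a b = (a == b)%:R.
Proof. by rewrite /entry mxE (inj_eq enum_rank_inj). Qed.

Lemma entry_tr A a b : entry A^T a b = entry A b a.
Proof. by rewrite /entry mxE. Qed.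

Lemma entry_ext A B : (forall a b, entry A a b = entry B a b) -> A = B.
Proof.
by move=> H; apply/matrixP => i j; have := H (enum_val i) (enum_val j); rewrite /entry !enum_valK.
Qed.
End Mx.

Section BoxMx.
Variables R C : nat.
Notation T := (bpart R C).
Definition box_mx (b : 'I_R * 'I_C) := fun_mx (fun mu nu : T => (adds_box b mu nu)%:R).
Definition add_mx (r : 'I_R) := fun_mx (fun mu nu : T => (covers r mu nu)%:R).
(** An ascent of the filling: the second box is not placed in a lower row. *)
Definition asc : rel 'I_R := fun r r' => (r' <= r)%N.

Lemma add_mx_sum r : add_mx r = \sum_c box_mx (r, c).
Proof.
apply: entry_ext => mu nu; rewrite entry_sum entry_fun_mx.
under eq_bigr do rewrite entry_fun_mx /adds_box /=.
case: (boolP (covers r mu nu)) => [cv|ncv]; last by rewrite big1.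
have lt : (prow mu r < C)%N by case/coversP: cv => _ /(_ r); rewrite eqxx;
  have := prow_le nu r; lia.
rewrite (bigD1 (Ordinal lt)) //= eqxx big1 ?addr0 // => c; rewrite -val_eqE /= eq_sym => /negPf ->.
by [].
Qed.

(** Words of a letters with rows weakly decreasing and smaller than s; each of
them adds a horizontal strip and each strip comes from exactly one of them. *)
Fixpoint strip_mx a s : 'M[int]_#|{: T}| :=
  if a is a'.+1 then \sum_(r : 'I_R | (r < s)%N) add_mx r * strip_mx a' r.+1 else 1.

Lemma entry_strip_mx a s mu nu : @entry T (strip_mx a s) mu nu = (hstrip a s mu nu)%:R.
Proof.
elim: a s mu => [|a IH] s mu /=; first by rewrite entry1 hstrip0.
rewrite entry_sum.
under eq_bigr do rewrite entry_mul.
under eq_bigr do under eq_bigr do rewrite entry_fun_mx IH -natrM mulnb.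
case: (boolP (hstrip a.+1 s mu nu)) => [hs|nhs]; last first.
  rewrite big1 // => r rs; rewrite big1 // => rho _; case: andP => // -[cv hs].
  by case: (covers_hstrip rs cv hs); rewrite (negPf nhs).
case: (hstrip_covers hs) => r0 [rho0 [rs cv hs0]].
have r0R : (r0 < R)%N by case/coversP: cv.
have [_ lt0 mx0] := covers_hstrip rs cv hs0.
rewrite (bigD1 (Ordinal r0R)) //= (bigD1 rho0) //= cv hs0 big1 ?addr0.
  rewrite big1 ?addr0 // => r /andP[rs1]; rewrite -val_eqE /= => ne.
  rewrite big1 // => rho _; case: andP => // -[cv1 hs1].
  have [_ lt1 mx1] := covers_hstrip rs1 cv1 hs1.
  case: (ltngtP (r : nat) r0) ne => // lt _; first by have := mx1 _ lt; lia.
  by have := mx0 _ lt; lia.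
move=> rho ne; case: andP => // -[cv1 _]; case/negP: ne; apply/eqP/prow_inj => i.
by case/coversP: cv => _ ->; case/coversP: cv1 => _ ->.
Qed.

Lemma wsum_strip_mx a : wsum add_mx asc (nseq a true) = strip_mx a.+1 R.
Proof.
have tl r : wtail add_mx asc (nseq a true) r = strip_mx a r.+1.
  elim: a r => [|a IH] r //=; apply: eq_big => [s|s _]; last by rewrite IH.
  by rewrite /asc ltnS; case: leqP.
by apply: eq_big => [s|s _]; [rewrite ltn_ord | rewrite tl].
Qed.

Lemma strip_mx_comm a b : strip_mx a R * strip_mx b R = strip_mx b R * strip_mx a R.
Proof.
have E c d mu nu : @entry T (strip_mx c R * strip_mx d R) mu nu =
   #|[set rho | hstrip c R mu rho && hstrip d R rho nu]|%:R.
  rewrite entry_mul -sum1_card natr_sum [RHS]big_mkcond; apply: eq_bigr => rho _.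
  by rewrite !entry_strip_mx inE; case: hstrip; case: hstrip.
by apply: entry_ext => mu nu; rewrite !E; congr _%:R; apply/eqP; rewrite eqn_leq !bk_card.
Qed.

Lemma wsum_add_rev p : wsum add_mx asc (rev p) = wsum add_mx asc p.
Proof.
by apply: wsum_rev => a b; rewrite /GRing.comm !wsum_strip_mx strip_mx_comm.
Qed.

Definition box_desc : rel ('I_R * 'I_C) := fun b b' => (b'.2 <= b.2)%N.
Lemma wsum_box_desc p : wsum add_mx asc p = wsum box_mx box_desc (map negb p).
Proof.
have -> : wsum add_mx asc p = wsum (fun i => \sum_j box_mx (i, j)) asc p.
  rewrite /wsum; apply: eq_bigr => s _; rewrite add_mx_sum; congr (_ * _).
  elim: p s => //= c p IH s; apply: eq_bigr => s' _; by rewrite add_mx_sum IH.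
rewrite -(wsum_row box_mx asc p); apply: wsum_neg => b b' /eqP ne.
rewrite /asc /box_desc; move: ne; apply: contra_not_eq => /eqP nb; apply: entry_ext => mu nu.
rewrite entry_mul [RHS]/entry [RHS]mxE big1 // => xi _; rewrite !entry_fun_mx.
case: (boolP (adds_box b mu xi)) => [b1|]; last by rewrite mul0r.
case: (boolP (adds_box b' xi nu)) => [b2|]; last by rewrite mulr0.
by case: nb; apply: adds_box_pair b1 b2.
Qed.
End BoxMx.

Lemma wsum_conj R C p (mu nu : bpart R C) :
  @entry (bpart R C) (wsum (@add_mx R C) (@asc R) p) mu nu =
    @entry (bpart C R) (wsum (@add_mx C R) (@asc C) (map negb p)) (conj_part mu) (conj_part nu).
Proof.
have -> : wsum (@add_mx C R) (@asc C) (map negb p) =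
  wsum (@box_mx C R) (fun b b' => asc b.1 b'.1) (map negb p).
  rewrite (wsum_row (@box_mx C R)) /wsum; apply: eq_bigr => s _; rewrite add_mx_sum; congr (_ * _).
  elim: (map negb p) s => //= c q IH s; apply: eq_bigr => s' _; by rewrite add_mx_sum IH.
rewrite wsum_box_desc; move: (map negb p) => q.
have bsw : bijective (@bswap 'I_C 'I_R) by exists bswap => -[].
have bcj : bijective (@conj_part R C) by exists (@conj_part C R); apply: conj_partK.
have X b m n : @entry (bpart C R) (@box_mx C R (bswap b)) (conj_part m) (conj_part n) =
  @entry (bpart R C) (@box_mx R C b) m n.
  by rewrite !entry_fun_mx adds_box_conj.
have Tl b m : @entry (bpart R C) (wtail (@box_mx R C) (@box_desc R C) q b) m nu =
   @entry (bpart C R) (wtail (@box_mx C R) (fun b b' => asc b.1 b'.1) q (bswap b)) (conj_part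
     m) (conj_part nu).
  elim: q b m => [|c q IH] b m /=; first by rewrite !entry1 (can_eq (@conj_partK _ _)).
  rewrite !entry_sum (reindex _ (onW_bij _ bsw)) /=; apply: eq_big => [[i j]|[i j] _] //.
  rewrite !entry_mul [RHS](reindex _ (onW_bij _ bcj)) /=; apply: eq_bigr => xi _.
  by rewrite IH -X.
rewrite !entry_sum (reindex _ (onW_bij _ bsw)) /=; apply: eq_bigr => -[i j] _.
rewrite !entry_mul [RHS](reindex _ (onW_bij _ bcj)) /=; apply: eq_bigr => xi _.
by rewrite Tl -X.
Qed.

(** The ascent pattern of a run with k peaks. *)
Definition altp k := flatten (nseq k [:: true; false]).
Lemma altp_rev k : rev (altp k) = map negb (altp k).
Proof.
elim: k => // k IH; rewrite {1}/altp -addn1 nseqD flatten_cat rev_cat IH /=.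
suff H : forall b, [:: false, true & map negb (altp b)] = map negb (altp b.+1) by rewrite H addn1.
by [].
Qed.

(** Conjugation negates the pattern, and the negation of an alternating pattern
of even length is its reverse. *)
Lemma altp_conj R C k (mu nu : bpart R C) :
  @entry (bpart R C) (wsum (@add_mx R C) (@asc R) (altp k)) mu nu =
    @entry (bpart C R) (wsum (@add_mx C R) (@asc C) (altp k)) (conj_part mu) (conj_part nu).
Proof. by rewrite wsum_conj -altp_rev wsum_add_rev. Qed.

Section Down.
Variables R C : nat.
(** Removing boxes is described by the transposed operators; a word that removes
boxes is a word that adds them, read backwards. *)
Definition del_mx (r : 'I_R) := (@add_mx R C r)^T.
Definition dsc : rel 'I_R := fun r r' => (r' < r)%N.
Lemma altp_down k mu nu : @entry (bpart R C) (wsum del_mx dsc (altp k)) mu nu =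
  @entry (bpart R C) (wsum (@add_mx R C) (@asc R) (altp k)) nu mu.
Proof.
rewrite -[RHS]entry_tr; congr (entry _ _ _).
rewrite (@wsum_anti _ _ _ (@trmx int _ _) (@add_mx R C) (@asc R) (altp k)); last 2 first.
- exact: trmx1.
- by move=> a b; exact: trmx_mul.
rewrite [RHS](@wsum_neg _ _ _ _ dsc); last by move=> s s' _; rewrite /asc /dsc -leqNgt.
rewrite altp_rev -map_comp map_id_in // => b _ /=; exact: negbK.
Qed.
End Down.
End PatternMatrices.

(** * Counting walks of partitions *)

(** A step of the walk: [None] does nothing, [Some (up, peak)] adds a box if
[up] and removes one otherwise; [peak] tells the peaks from the valleys of a
run. *)
Definition step_kind := option (bool * bool).

(** Around a peak x alternation requires u(x-1) >= u(x) < u(x+1) for the labels.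
The steps which remove boxes meet the indices in decreasing order, hence the
mirrored inequalities. *)
Definition labels_ok (d0 : step_kind) (r0 : nat) (d : step_kind) (r : nat) : bool :=
  match d0, d with
  | Some (_, p0), Some (up, p) =>
    if p then (if up then r <= r0 else r < r0)
    else if p0 then (if up then r0 < r else r0 <= r) else true
  | _, _ => true
  end.

Definition is_peak (d : step_kind) := if d is Some (_, true) then true else false.

Definition run_steps up k : seq step_kind :=
  Some (up, false) :: flatten (nseq k [:: Some (up, true); Some (up, false)]).

Lemma labels_ok_valleys d0 r0 d r : ~~ is_peak d0 -> ~~ is_peak d -> labels_ok d0 r0 d r.
Proof. by case: d0 => [[u0 []]|]; case: d => [[u []]|]. Qed.

Inductive are_runs : seq step_kind -> Prop :=
| are_runs_nil : are_runs [::]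
| are_runs_skip ds : are_runs ds -> are_runs (None :: ds)
| are_runs_run up k ds : are_runs ds -> are_runs (run_steps up k ++ ds).

Lemma are_runs_head ds : are_runs ds -> ~~ is_peak (head None ds).
Proof. by case. Qed.

Lemma big_tuple_cons (A : finType) n (V : nmodType) (f : n.+1.-tuple A -> V) :
  (\sum_t f t = \sum_a \sum_(t : n.-tuple A) f [tuple of a :: t])%R.
Proof.
rewrite pair_big (reindex (fun p : A * n.-tuple A => [tuple of p.1 :: p.2])) //=.
exists (fun t => (thead t, [tuple of behead t])) => [[a t] _|t _] /=.
  by congr pair; apply: val_inj.
by rewrite -tuple_eta.
Qed.

Lemma big_pairT (A B : finType) (V : nmodType) (f : A * B -> V) :
  (\sum_x f x = \sum_a \sum_b f (a, b))%R.
Proof. by rewrite pair_big; apply: eq_bigr => -[]. Qed.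

Section Walk.
Variables R C : nat.
Notation T := (bpart R C).
Notation elt := (step_kind * ('I_R.+1 * T))%type.

Definition moves (d : step_kind) (r : nat) (mu nu : T) : bool :=
  match d with
  | None => (r == 0) && (mu == nu)
  | Some (up, _) => (0 < r) && (if up then covers r.-1 mu nu else covers r.-1 nu mu)
  end.

Definition ok_step (e e' : elt) :=
  moves e'.1 e'.2.1 e.2.2 e'.2.2 && labels_ok e.1 e.2.1 e'.1 e'.2.1.

Local Open Scope ring_scope.
(** The number of walks with steps [ds] that continue [e], the previous step
together with its label and the partition reached ([nwalk_card]). *)
Fixpoint nwalk (ds : seq step_kind) (e : elt) : int :=
  if ds is d :: ds' then \sum_(x : 'I_R.+1 * T) (ok_step e (d, x))%:R * nwalk ds' (d, x) else 1.

Lemma nwalk_card ds e :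
  nwalk ds e = #|[set w : (size ds).-tuple ('I_R.+1 * T)%type | path ok_step e (zip ds w)]|%:R.
Proof.
rewrite -sum1_card natr_sum.
under eq_bigl do rewrite inE.
rewrite big_mkcond; elim: ds e => [|d ds IH] e /=.
  rewrite (bigD1 [tuple]) //= big1 ?addr0 // => t /negP[]; apply/eqP.
  by rewrite tuple0.
rewrite big_tuple_cons /=; apply: eq_bigr => x _; rewrite IH big_distrr /=.
by apply: eq_bigr => t _; case: ok_step => /=; [rewrite mul1r | rewrite mul0r].
Qed.

(** The labels of two consecutive valleys are not compared. *)
Lemma nwalk_indep ds e e' : ~~ is_peak (head None ds) -> ~~ is_peak e.1 -> ~~ is_peak e'.1 ->
  e.2.2 = e'.2.2 -> nwalk ds e = nwalk ds e'.
Proof.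
case: ds => //= d ds pd pe pe' eq; apply: eq_bigr => x _.
by rewrite /ok_step eq !labels_ok_valleys.
Qed.

Definition step_mx (up : bool) := if up then @add_mx R C else @del_mx R C.
Definition step_rel (up : bool) := if up then @asc R else @dsc R.

Lemma nwalk_step up p ds e :
  nwalk (Some (up, p) :: ds) e = \sum_(i : 'I_R) \sum_(rho : T)
    (@entry T (step_mx up i) e.2.2 rho * (labels_ok e.1 e.2.1 (Some (up, p)) i.+1)%:R) *
      nwalk ds (Some (up, p), (lift ord0 i, rho)).
Proof.
rewrite /= big_pairT.
rewrite big_ord_recl /= big1 ?add0r; last first.
  by move=> rho _; rewrite /ok_step /= mul0r.
apply: eq_bigr => i _; apply: eq_bigr => rho _; congr (_ * _).
rewrite /ok_step -[labels_ok e.1 e.2.1 _ i.+1]/(labels_ok e.1 e.2.1 (Some (up, p)) (lift ord0 i)).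
have -> : @entry T (step_mx up i) e.2.2 rho = (moves (Some (up, p)) (lift ord0 i) e.2.2 rho)%:R.
  by case: up; rewrite /= /del_mx ?entry_tr entry_fun_mx.
by rewrite -natrM mulnb.
Qed.

Lemma labels_ok_peak up (i j : 'I_R) :
  labels_ok (Some (up, false)) (lift ord0 i) (Some (up, true)) j.+1 = step_rel up i j.
Proof. by case: up => /=; rewrite /bump /asc /dsc; lia. Qed.

Lemma labels_ok_valley up (i j : 'I_R) :
  labels_ok (Some (up, true)) (lift ord0 i) (Some (up, false)) j.+1 = ~~ step_rel up i j.
Proof. by case: up => /=; rewrite /bump /asc /dsc; lia. Qed.

Lemma nwalk_tail up k ds i mu : are_runs ds ->
  nwalk (flatten (nseq k [:: Some (up, true);
    Some (up, false)]) ++ ds) (Some (up, false), (lift ord0 i, mu)) =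
  \sum_nu @entry T (wtail (step_mx up) (step_rel up) (altp k) i) mu nu *
    nwalk ds (None, (ord0, nu)).
Proof.
move=> rds; have hd := are_runs_head rds.
elim: k i mu => [|k IH] i mu.
  rewrite [LHS](@nwalk_indep _ _ (None, (ord0, mu))) //= (bigD1 mu) //= big1 ?addr0.
    by rewrite entry1 eqxx mul1r.
  by move=> nu ne; rewrite entry1 eq_sym (negPf ne) mul0r.
have E (F : T -> int) (B : pred 'I_R) (W : 'I_R -> 'M[int]_#|{: T}|) m :
  \sum_nu @entry T (\sum_(j | B j) step_mx up j * W j) m nu * F nu =
  \sum_j \sum_(rho : T) (@entry T (step_mx up j) m rho * (B j)%:R) * \sum_nu @entry T (W j) rho
    nu * F nu.
  under eq_bigr do rewrite entry_sum mulr_suml.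
  rewrite exchange_big /= big_mkcond /=; apply: eq_bigr => j _.
  case: ifP => Bj; last first.
    by rewrite big1 // => rho _; rewrite mulr0 mul0r.
  under eq_bigr do rewrite entry_mul mulr_suml.
  rewrite exchange_big /=; apply: eq_bigr => rho _; rewrite mulr1 mulr_sumr.
  by apply: eq_bigr => nu _; rewrite mulrA.
have -> : altp k.+1 = true :: false :: altp k by [].
rewrite [wtail _ _ (_ :: _) _]/= E.
rewrite [flatten _]/= !cat_cons nwalk_step.
apply: eq_bigr => j _; apply: eq_bigr => rho _; congr (_ * _).
  by rewrite eqb_id labels_ok_peak.
rewrite E nwalk_step.
apply: eq_bigr => j' _; apply: eq_bigr => rho' _; congr (_ * _); last by rewrite IH.
by rewrite eqbF_neg labels_ok_valley.
Qed.

(** A run is preceded and followed by valleys or idle steps, so its labels are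
subject only to the conditions inside the run. *)
Lemma nwalk_run up k ds e : are_runs ds -> ~~ is_peak e.1 ->
  nwalk (run_steps up k ++ ds) e =
  \sum_nu @entry T (wsum (step_mx up) (step_rel up) (altp k)) e.2.2 nu *
    nwalk ds (None, (ord0, nu)).
Proof.
move=> rds pe; rewrite nwalk_step.
under eq_bigr => i _ do under eq_bigr => rho _ do rewrite nwalk_tail //.
under [RHS]eq_bigr do rewrite entry_sum mulr_suml.
rewrite [RHS]exchange_big /=; apply: eq_bigr => i _.
under [RHS]eq_bigr do rewrite entry_mul mulr_suml.
rewrite [RHS]exchange_big /=; apply: eq_bigr => rho _.
rewrite mulr_sumr; apply: eq_bigr => nu _.
by rewrite -!mulrA; case: e pe => [[[u []]|] [r m]] //= _; rewrite mul1r.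
Qed.
End Walk.

(** Run by run, [altp_conj] compares the numbers of chains between two
partitions and between their conjugates. *)
Lemma nwalk_conj R C ds (mu : bpart R C) : are_runs ds ->
  nwalk ds (None, (ord0, mu)) = nwalk ds (None, (ord0, conj_part mu)).
Proof.
move=> rds; elim: rds mu => [|{}ds rds IH|up k {}ds rds IH] mu //.
  have E R' C' (m : bpart R' C') : 
    nwalk (None :: ds) (None, (ord0, m)) = nwalk ds (None, (ord0, m)).
    rewrite /= (bigD1 (ord0, m)) //= big1 ?addr0; last first.
      case=> r nu; rewrite /ok_step /= => ne; case: andP => [[/andP[/eqP r0 /eqP e] _]|];
        last by rewrite mul0r.
      case/negP: ne; rewrite e; apply/eqP; congr pair; exact/val_inj.
    by rewrite /ok_step /= !eqxx mul1r.
  by rewrite !E IH.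
have bcj : bijective (@conj_part R C) by exists (@conj_part C R); apply: conj_partK.
rewrite !nwalk_run //= [RHS](reindex _ (onW_bij _ bcj)) /=; apply: eq_bigr => nu _.
rewrite IH; congr (_ * _)%R.
by case: up; rewrite /step_mx /step_rel ?altp_down altp_conj.
Qed.

(** * Fillings of the staircase and walks along its boundary *)

Lemma path_mkseqP (T : Type) (r : rel T) e0 (E : nat -> T) n :
  reflect (forall t, t < n -> r (if t is t'.+1 then E t' else e0) (E t)) (path r e0 (mkseq E n)).
Proof.
apply: (iffP (pathP e0)) => [H t lt|H t].
  by have := H t; rewrite size_mkseq nth_mkseq //; case: t lt => [|t] lt;
    [|rewrite /= nth_mkseq; last lia]; exact.
by rewrite size_mkseq => lt; rewrite nth_mkseq //; case: t lt (H t lt) => [|t] lt //=;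
  rewrite nth_mkseq //; lia.
Qed.

Section Fill.
Variable n : nat.
Let N := n + n.
Variables (Q Pk : nat -> bool).
Hypothesis Q_lt : forall x, Q x -> x < N.
Hypothesis Q_excl : forall x y, Q x -> Q y -> x + y + 1 <> N.
Hypothesis Pk_nbr : forall x, Pk x -> [/\ 0 < x, Q x.-1, Q x & Q x.+1].
Hypothesis Pk_val : forall x, Pk x -> ~~ Pk x.+1.

(** Step t of the boundary path traverses column t if t is in [Q], and row
N - t - 1 if that index is in [Q]; [Q_excl] says that both cannot happen. *)
Definition kind_at t : step_kind :=
  if Q t then Some (true, Pk t) else if Q (N - t.+1) then Some (false, Pk (N - t.+1)) else None.

(** By [Q_excl] a peak is not the last step before the diagonal, so both its
neighbours belong to the half walk and go in the same direction. *)
Lemma kind_at_peak t up : t < n -> kind_at t = Some (up, true) ->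
  [/\ 0 < t, kind_at t.-1 = Some (up, false), t.+1 < n & kind_at t.+1 = Some (up, false)].
Proof.
move=> lt; rewrite {1}/kind_at; case: (boolP (Q t)) => [Qt [<- P]|nQ].
  have [t0 Q1 _ Q2] := Pk_nbr P.
  have lt1 : t.+1 < n.
    by case: (ltnP t.+1 n) => // ge; case: (Q_excl Qt Q2); rewrite /N; lia.
  split => //; rewrite /kind_at ?Q1 ?Q2; congr (Some (_, _)); apply/negbTE; last exact: Pk_val.
  by apply/negP => /Pk_val; rewrite prednK // P.
case: (boolP (Q (N - t.+1))) => // Qt [<- P].
have [t0 Q1 _ Q2] := Pk_nbr P.
have lt1 : t.+1 < n.
  by case: (ltnP t.+1 n) => // ge; case: (Q_excl Qt Q1); rewrite /N; lia.
have e1 : (N - t.+1).-1 = N - t.+2 by lia.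
have t1 : 0 < t by move: (Q_lt Q2); rewrite /N; lia.
have e2 : (N - t.+1).+1 = N - t.-1.+1 by rewrite /N; lia.
have x1 : Q t.+1 = false by apply/negP => q; apply: (Q_excl q Q1); rewrite /N; lia.
have x2 : Q t.-1 = false by apply/negP => q; apply: (Q_excl q Q2); rewrite /N; lia.
rewrite /kind_at x1 x2 -e2 -e1 Q1 Q2; split => //; congr (Some (_, _)); apply/negbTE;
  first exact: Pk_val.
by apply/negP => /Pk_val; rewrite prednK // P.
Qed.

Lemma kinds_from_runs m t : t + m = n -> (forall up, kind_at t <> Some (up, true)) \/ m = 0 ->
  are_runs [seq kind_at i | i <- iota t m].
Proof.
have [k] := ubnP m; elim: k m t => // k IH [|m] t lm e; first by move=> _; exact: are_runs_nil.
case=> // np.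
have rec m' t' : m' < m.+1 -> t' + m' = n -> t' = n \/ ~~ is_peak (kind_at t') ->
  are_runs [seq kind_at i | i <- iota t' m'].
  move=> l1 l2 l3; apply: IH => //; first lia.
  case: l3 => [?|np']; first by right; lia.
  by left => up eq; rewrite eq in np'.
case es : (kind_at t) => [[up p]|]; last first.
  rewrite /= es; apply: are_runs_skip; apply: rec => //; try lia.
  case: (eqVneq t.+1 n) => [|ne]; [by left | right].
  apply/negP; case es' : (kind_at t.+1) => [[u []]|] // _.
  by case: (kind_at_peak _ es'); rewrite ?es //; lia.
have {}es : kind_at t = Some (up, false) by case: p es => // /np.
(* A run is extended by two steps as long as the next step is a peak. *)
suff [j [ds [-> rds]]] : exists j ds, [seq kind_at i | i <- iota t m.+1] =
  run_steps up j ++ ds /\ are_runs ds.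
  exact: are_runs_run.
clear np; elim: m.+1 {-2}m t (leqnn m.+1) lm e rec es => // q IHq m0 t lq lm e rec es.
case: (boolP ((t.+1 < n) && is_peak (kind_at t.+1))) => [/andP[lt pk]|np]; last first.
  exists 0, [seq kind_at i | i <- iota t.+1 m0]; rewrite /run_steps /= es; split=> //.
  apply: rec => //; try lia.
have [u eu] : exists u, kind_at t.+1 = Some (u, true).
  by case: (kind_at t.+1) pk => [[u []]|] // _; exists u.
have [_ /= e0 lt2 e2] := kind_at_peak lt eu.
have eu' : u = up by move: e0; rewrite es => -[].
case: m0 lq lm e rec => [|[|m0]] lq lm e rec; try lia.
have [|||||j [ds [ej rds]]] := IHq m0 t.+2; try lia; rewrite ?e2 ?eu' //; try lia.
  by move=> m' t' l1; apply: rec; lia.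
exists j.+1, ds; split => //.
by rewrite [iota _ _]/= !map_cons es eu eu' -[in LHS]map_cons; congr [:: _, _ & _].
Qed.

Definition kinds := mkseq kind_at n.
Lemma kinds_runs : are_runs kinds.
Proof.
apply: kinds_from_runs => //; case: (posnP n) => [|n0]; [by right | left => up e].
by case: (kind_at_peak n0 e).
Qed.

(** The symmetric fillings that encode the members of a class: [Q] holds the
nonempty columns and [Pk] those which are peaks. *)
Record filling (X : nat -> nat -> bool) : Prop := Filling {
  fill_sym : forall x y, X x y = X y x;
  fill_fun : forall x y y', X x y -> X x y' -> y = y';
  fill_dom : forall x y, X x y -> Q x;
  fill_in : forall x y, X x y -> x + y + 2 <= N;
  fill_tot : forall x, Q x -> exists y, X x y;
  fill_peak : forall x e f g, Pk x -> X x.-1 e -> X x f -> X x.+1 g -> e < f /\ g < f }.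

Definition boundary X x := hlab X x (N - x.+1).

Definition peaks_ok (u : nat -> nat) := forall x, Pk x -> u x <= u x.-1 /\ u x < u x.+1.

(** At most one of the two summands is nonzero, the one for the column or row
traversed at time t. *)
Definition step_label (u : nat -> nat) t := u t + u (N - t.+1).

Lemma step_label_up (u : nat -> nat) t : (forall x, ~~ Q x -> u x = 0) -> Q t ->
  step_label u t = u t.
Proof.
move=> u0 Qt; rewrite /step_label (u0 (N - t.+1)) ?addn0 //; apply/negP => Q1.
by apply: (Q_excl Qt Q1); have := Q_lt Qt; lia.
Qed.

Lemma step_label_down (u : nat -> nat) t : t < N -> (forall x, ~~ Q x -> u x = 0) ->
  Q (N - t.+1) -> step_label u t = u (N - t.+1).
Proof.
move=> lt u0 Qt; rewrite /step_label (u0 t) //; apply/negP => Q1.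
by apply: (Q_excl Qt Q1); lia.
Qed.

Lemma peaks_labels_ok u : (forall x, ~~ Q x -> u x = 0) ->
  (peaks_ok u <-> forall t, t.+1 < n ->
    labels_ok (kind_at t) (step_label u t) (kind_at t.+1) (step_label u t.+1)).
Proof.
move=> u0; split => [P t lt|H x Px].
- case e1 : (kind_at t.+1) => [[up p]|]; last by case: (kind_at t) => [[]|].
  case: p e1 => e1.
    have [_ /= e0 _ _] := kind_at_peak lt e1; rewrite e0 /=.
    move: e0 e1; rewrite /kind_at; case: (boolP (Q t)) => [Qt [<- _]|nQ].
      case: (boolP (Q t.+1)) => [Q1 [P1]|nQ1]; last by case: ifP.
      by rewrite !step_label_up //; case: (P _ P1).
    case: (boolP (Q (N - t.+1))) => // Q1 [<- _]; case: ifP => // nQ1.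
    case: (boolP (Q (N - t.+2))) => // Q2 [P2]; rewrite !step_label_down //; try (rewrite /N; lia).
    have [x0 _ _ _] := Pk_nbr P2.
    have e : (N - t.+2).+1 = N - t.+1 by lia.
    by have [_] := P _ P2; rewrite e.
  case e0 : (kind_at t) => [[u1 p1]|] //=; case: p1 e0 => // e0.
  have [_ _ _] := kind_at_peak (ltnW lt) e0; rewrite e1 => -[eu]; rewrite {}eu in e1 *.
  move: e0 e1; rewrite /kind_at; case: (boolP (Q t)) => [Qt [<- Pt]|nQ].
    case: (boolP (Q t.+1)) => [Q1 _|nQ1]; last by case: ifP.
    by rewrite !step_label_up //; case: (P _ Pt).
  case: (boolP (Q (N - t.+1))) => // Q1 [<- P1]; case: ifP => // nQ1.
  case: (boolP (Q (N - t.+2))) => // Q2 _; rewrite !step_label_down //; try (rewrite /N; lia).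
  have e : (N - t.+1).-1 = N - t.+2 by lia.
  by have [] := P _ P1; rewrite e.
- have [x0 Q1 Qx Q2] := Pk_nbr Px.
  case: (ltnP x n) => lx.
    have e : kind_at x = Some (true, true) by rewrite /kind_at Qx Px.
    have [_ e1 lt e2] := kind_at_peak lx e.
    have := H x.-1; rewrite prednK // e e1 !step_label_up //= => -> //.
    by have := H x lt; rewrite e e2 !step_label_up.
  have ltN := Q_lt Q2.
  pose t := N - x.+1; have et : x = N - t.+1 by rewrite /t; move: lx; rewrite /N; lia.
  have ltn : t < n by rewrite /t; move: lx ltN; rewrite /N; lia.
  have nQt : Q t = false by apply/negP => q; apply: (Q_excl q Qx); rewrite /t; lia.
  have e : kind_at t = Some (false, true) by rewrite /kind_at nQt -et Qx Px.
  have [t0 e1 lt e2] := kind_at_peak ltn e.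
  have x1 : x.-1 = N - t.+2 by lia.
  have x2 : x.+1 = N - t.-1.+1 by lia.
  have := H t lt; rewrite e e2.
  rewrite (step_label_down _ _ (t := t)) -?et // ?step_label_down -?x1 //=; try lia.
  have := H t.-1; rewrite prednK // e e1.
  by rewrite (step_label_down _ _ (t := t)) -?et // ?step_label_down -?x2 //=; try lia.
Qed.

Section OneFilling.
Variables (X : nat -> nat -> bool).
Hypotheses (symX : forall x y, X x y = X y x) (funX : forall x y y', X x y -> X x y' -> y = y')
  (domX : forall x y, X x y -> Q x) (inX : forall x y, X x y -> x + y + 2 <= N).

Lemma fill_growth_at m : growth m X (hlab X) (vlab X).
Proof. by apply: growth_lab => // x x' y; rewrite !(symX _ y); apply: funX. Qed.

Lemma fill_growth : growth N X (hlab X) (vlab X).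
Proof. exact: fill_growth_at. Qed.

Lemma boundary_notQ x : ~~ Q x -> boundary X x = 0.
Proof.
move=> nQ; apply/eqP; rewrite -leqn0 leqNgt; apply/negP => /hlab_gt0[y _ /domX]; exact/negP.
Qed.

Lemma boundary_dot x y : X x y -> 0 < boundary X x.
Proof.
move=> Xxy; have lc := inX Xxy; have [_ _ e _] := dot_labels fill_growth lc Xxy.
by apply: leq_trans (h_mono fill_growth (_ : y.+1 <= N - x.+1) _); rewrite ?e //; lia.
Qed.

Lemma boundary_row x : x < N -> vlab X x (N - x.+1) = boundary X (N - x.+1).
Proof.
move=> lt; rewrite /boundary; have -> : N - (N - x.+1).+1 = x by lia.
by rewrite (growth_sym fill_growth symX) //; lia.
Qed.

(** The labels of columns x and x + 1 are read at heights that differ by one;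
the row in between is empty, because x + 1 is in [Q], and leaves the label of
column x unchanged. *)
Lemma ascent_boundary x f g : Q x -> Q x.+1 -> X x f -> X x.+1 g -> f != g ->
  (f < g) = (boundary X x.+1 <= boundary X x).
Proof.
move=> Qx Qx1 Xf Xg ne.
have l1 := inX Xf; have l2 := inX Xg; have lx := Q_lt Qx1.
have ly : x + (N - x.+2) + 1 < N by lia.
have lf : f < N - x.+2.
  have : f <> N - x.+2.
    by move=> e; apply: (Q_excl Qx1 (domX _ : Q f)); [rewrite symX; exact: Xf | lia].
  by lia.
rewrite (asc_label fill_growth Xf Xg ly lf) //; last lia.
rewrite {1}/boundary; congr (_ <= _).
have lc : x + (N - x.+2) + 2 <= N by lia.
have vz : vlab X x (N - x.+2) = 0.
  apply/eqP; rewrite -leqn0 leqNgt; apply/negP => /vlab_gt0[x' _]; rewrite symX => /domX q.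
  by apply: (Q_excl Qx1 q); lia.
have hp : 0 < hlab X x (N - x.+2).
  have [_ _ e _] := dot_labels fill_growth l1 Xf.
  by apply: leq_trans (h_mono fill_growth (_ : f.+1 <= N - x.+2) _); rewrite ?e //; lia.
rewrite /boundary; have -> : N - x.+1 = (N - x.+2).+1 by lia.
by case: (cell_cases fill_growth lc) => [][]; lia.
Qed.

Lemma peaks_boundary : (forall x, Q x -> exists y, X x y) ->
  (forall x e f g, Pk x -> X x.-1 e -> X x f -> X x.+1 g -> e < f /\ g < f) <->
    peaks_ok (boundary X).
Proof.
move=> totX.
have ne x y e f : x != y -> X x e -> X y f -> e != f.
  move=> xy Xe Xf; apply/eqP => ef; case/eqP: xy; rewrite symX ef in Xe; rewrite symX in Xf;
    exact: funX Xe Xf.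
split=> [H x Px|H x e f g Px Xe Xf Xg]; have [x0 Q1 Qx Q2] := Pk_nbr Px.
- have [e Xe] := totX _ Q1; have [f Xf] := totX _ Qx; have [g Xg] := totX _ Q2.
  have [lt1 lt2] := H _ _ _ _ Px Xe Xf Xg.
  have := @ascent_boundary x.-1 e f Q1;
    rewrite prednK // => /(_ Qx Xe Xf (ne _ _ _ _ _ Xe Xf)) <-; last lia.
  have := ascent_boundary Qx Q2 Xf Xg (ne _ _ _ _ _ Xf Xg); lia.
- have [le lt] := H _ Px.
  have n1 : e != f by apply: ne Xe Xf; lia.
  have n2 : f != g by apply: ne Xf Xg; lia.
  have := @ascent_boundary x.-1 e f Q1; rewrite prednK // => /(_ Qx Xe Xf n1) ->.
  by have := ascent_boundary Qx Q2 Xf Xg n2; lia.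
Qed.
End OneFilling.

Section Box.
Variables R C : nat.

(** The partitions along the boundary have at most R rows and at most C columns.
By symmetry the first half of the boundary is enough for the columns. *)
Definition in_box X := [forall x : 'I_N, boundary X x <= R] &&
  [forall t : 'I_n.+1, rowlen (hlab X) 1 t (N - t) <= C].

Lemma in_boxP X : reflect ((forall x, x < N -> boundary X x <= R) /\
    (forall t, t <= n -> rowlen (hlab X) 1 t (N - t) <= C)) (in_box X).
Proof.
apply: (iffP andP) => [[/forallP H1 /forallP H2]|[H1 H2]].
  split=> [x lt|t lt]; first exact: (H1 (Ordinal lt)).
  by rewrite -ltnS in lt; exact: (H2 (Ordinal lt)).
by split; apply/forallP => i; [apply: H1 | apply: H2; rewrite -ltnS]; exact: ltn_ord.
Qed.

Definition walk_state X t : bpart R C := mk_bpart R C (fun r => rowlen (hlab X) r.+1 t (N - t)).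
Definition walk_start : 'I_R.+1 * bpart R C := (ord0, bpart0 R C).
Definition walk_step X t : 'I_R.+1 * bpart R C :=
  (inord (step_label (boundary X) t), walk_state X t.+1).
Definition walk X : seq ('I_R.+1 * bpart R C) := mkseq (walk_step X) n.
Definition is_walk w := path (@ok_step R C) (None, walk_start) (zip kinds w).

Lemma is_walkP (w : nat -> 'I_R.+1 * bpart R C) : reflect
  ((forall t, t < n -> moves (kind_at t) (w t).1 (if t is t'.+1 then (w t').2 else bpart0 R C)
    (w t).2) /\
   (forall t, t.+1 < n -> labels_ok (kind_at t) (w t).1 (kind_at t.+1) (w t.+1).1))
  (is_walk (mkseq w n)).
Proof.
rewrite /is_walk /kinds /mkseq zip_map -/(mkseq (fun t => (kind_at t, w t)) n).
apply: (iffP (path_mkseqP _ _ _ _)) => [H|[H1 H2] t lt].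
  split=> t lt; first by have /andP[] := H t lt; case: t lt.
  by have /andP[] := H t.+1 lt.
by rewrite /ok_step; case: t lt => [|t] lt; rewrite ?(H1 _ lt) ?H2 //=; case: (kind_at 0) => [[]|].
Qed.

Lemma walk_state_bounded X : filling X -> in_box X -> forall t, t <= n ->
  bounded_rows R C (fun r => rowlen (hlab X) r.+1 t (N - t)).
Proof.
case=> sX fX dX iX _ _ /in_boxP[bR bC] t lt; have G := fill_growth sX fX.
have le : t + (N - t) <= N by rewrite /N; lia.
have mono i j : i <= j -> rowlen (hlab X) j.+1 t (N - t) <= rowlen (hlab X) i.+1 t (N - t).
  elim: j => [|j IH]; first by rewrite leqn0 => /eqP ->.
  rewrite leq_eqVlt => /predU1P[-> //|/IH]; apply: leq_trans; exact: (rowlen_part G).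
split=> // [i|i Ri]; first exact: leq_trans (mono 0 i (leq0n _)) (bC t lt).
rewrite /rowlen big1 // => x _; have ltx := ltn_ord x.
have ltN : x < N by rewrite /N; lia.
have := bR x ltN; have := h_mono G (_ : N - t <= N - x.+1) (_ : x + (N - x.+1) < N).
by rewrite -/(boundary X x) /N => /(_ ltac:(lia) ltac:(lia)); case: eqP => //; lia.
Qed.

Lemma prow_walk_state X : filling X -> in_box X -> forall t r, t <= n ->
  prow (walk_state X t) r = rowlen (hlab X) r.+1 t (N - t).
Proof. by move=> F B t r lt; rewrite mk_bpartE //; apply: walk_state_bounded. Qed.

(** The vertical edge crossed at time t has the label of the column with the
mirrored index. *)
Lemma rowlen_step X : filling X -> forall t r, t < n -> 0 < r ->
  rowlen (hlab X) r t.+1 (N - t.+1) + (boundary X (N - t.+1) == r) =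
    rowlen (hlab X) r t (N - t) + (boundary X t == r).
Proof.
case=> sX fX dX iX _ _ t r lt r0; have G := fill_growth sX fX.
rewrite rowlenS -/(boundary X t) -(boundary_row sX fX) /N; last lia.
have -> : n + n - t = (n + n - t.+1).+1 by lia.
by rewrite (rowlen_v G) // /N; lia.
Qed.

Lemma step_label_le X : filling X -> in_box X -> forall t, t < n -> step_label (boundary X) t <= R.
Proof.
case=> sX fX dX iX _ _ /in_boxP[bR _] t lt.
have u0 := boundary_notQ dX.
have ltN : t < N by rewrite /N; lia.
case: (boolP (Q t)) => Qt; first by rewrite step_label_up // bR.
case: (boolP (Q (N - t.+1))) => Qt'; first by rewrite step_label_down // bR //; rewrite /N; lia.
by rewrite /step_label !u0.
Qed.

Lemma walk_is_walk X : filling X -> in_box X -> is_walk (walk X).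
Proof.
move=> F B; case: (F) => sX fX dX iX tX pX.
have u0 := boundary_notQ dX.
have pos x : Q x -> 0 < boundary X x by case/tX => y; apply: boundary_dot.
apply/is_walkP; split=> t lt; last first.
  rewrite /walk_step /= !inordK ?ltnS; try (apply: step_label_le => //; lia).
  by move: t lt; apply/(peaks_labels_ok u0)/peaks_boundary.
have -> : (if t is t'.+1 then (walk_step X t').2 else bpart0 R C) = walk_state X t.
  case: t lt => [|t] lt //; apply: prow_inj => i.
  by rewrite prow0 prow_walk_state // /rowlen big_ord0.
have le := step_label_le F B lt; rewrite /walk_step /= inordK // /moves /kind_at.
have S r := rowlen_step F lt (isT : 0 < r.+1).
have ltN : t < N by rewrite /N; lia.
case: (boolP (Q t)) => Qt.
  move: le; rewrite step_label_up // => le; rewrite pos //=.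
  have z : boundary X (N - t.+1) = 0 by apply: u0; apply/negP => q; apply: (Q_excl Qt q); lia.
  apply/coversP; split; first by have := pos _ Qt; lia.
  move=> i; rewrite !prow_walk_state //; last lia.
  by have := S i; have := pos _ Qt; rewrite z; lia.
case: (boolP (Q (N - t.+1))) => Qt'.
  move: le; rewrite step_label_down // => le; rewrite pos //=.
  apply/coversP; split; first by have := pos _ Qt'; lia.
  move=> i; rewrite !prow_walk_state //; last lia.
  by have := S i; have := pos _ Qt'; rewrite (u0 t) //; lia.
rewrite /step_label !u0 //=; apply/eqP/prow_inj => i; rewrite !prow_walk_state //; last lia.
by have := S i; rewrite !u0 //=; lia.
Qed.

Lemma walk_inj X X' : filling X -> filling X' -> in_box X -> in_box X' -> walk X = walk X' ->
  forall x y, X x y = X' x y.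
Proof.
move=> F F' B B' e.
have el t : t < n -> step_label (boundary X) t = step_label (boundary X') t.
  move=> lt; have : nth walk_start (walk X) t = nth walk_start (walk X') t by rewrite e.
  rewrite !nth_mkseq // => -[e1 _]; have := congr1 val e1.
  by rewrite /= !inordK // ltnS; apply: step_label_le.
case: (F) => sX fX dX iX tX pX; case: (F') => sX' fX' dX' iX' tX' pX'.
have u0 := boundary_notQ dX; have u0' := boundary_notQ dX'.
have eb x : x < N -> boundary X x = boundary X' x.
  move=> lt; case: (boolP (Q x)) => Qx; last by rewrite u0 // u0'.
  case: (ltnP x n) => lx; first by have := el x lx; rewrite !step_label_up.
  have lx' : N - x.+1 < n by move: lx lt; rewrite /N; lia.
  have ex : N - (N - x.+1).+1 = x by lia.
  by have := el _ lx'; rewrite !step_label_down ?ex //; lia.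
move=> x y; case: (leqP (x + y + 2) N) => [lc|gt]; last first.
  by apply/idP/idP => [/iX|/iX']; lia.
apply: (growth_boundary_det (fill_growth sX fX) (fill_growth sX' fX')) => // {lc} {}x {}y exy.
have -> : y = N - x.+1 by lia.
by rewrite !boundary_row -/(boundary X x) -/(boundary X' x) ?eb //; lia.
Qed.

(** The half walk is unfolded to a symmetric walk along the zigzag between the
levels N and N - 1, whose partition at x is the one at the nearer end of the
path, and the growth diagram is rebuilt downwards from it. *)
Lemma walk_surj w : 0 < n -> size w = n -> is_walk w ->
  exists X, [/\ filling X, in_box X & walk X = w].
Proof.
move=> n0 sw; have -> : w = mkseq (nth walk_start w) n by rewrite -sw mkseq_nth.
case/is_walkP; set W := nth walk_start w => tW cW.
pose lab t : nat := (W t).1.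
pose st t : bpart R C := if t is t'.+1 then (W t').2 else bpart0 R C.
have {}tW t : t < n -> moves (kind_at t) (lab t) (st t) (st t.+1) by exact: tW.
pose u x := if Q x then (if x < n then lab x else lab (N - x.+1)) else 0.
have u0 x : ~~ Q x -> u x = 0 by rewrite /u => /negPf ->.
have lu t : t < n -> step_label u t = lab t.
  move=> lt; have ltN : t < N by rewrite /N; lia.
  case: (boolP (Q t)) => Qt; first by rewrite step_label_up // /u Qt lt.
  case: (boolP (Q (N - t.+1))) => Qt'.
    rewrite step_label_down // /u Qt'; have -> : (N - t.+1 < n) = false by rewrite /N; lia.
    by congr lab; lia.
  by rewrite /step_label !u0 //;
    have := tW t lt; rewrite /kind_at (negPf Qt) (negPf Qt') => /andP[/eqP ->].
have Qpos x : Q x -> 0 < u x.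
  move=> Qx; have ltN := Q_lt Qx; case: (ltnP x n) => lx.
    by rewrite -(step_label_up u0 Qx) lu //; have := tW x lx; rewrite /kind_at Qx => /andP[].
  have lx' : N - x.+1 < n by move: lx ltN; rewrite /N; lia.
  have ex : N - (N - x.+1).+1 = x by lia.
  have := lu _ lx'; rewrite step_label_down ?ex //; last lia; move=> ->.
  have := tW _ lx'; rewrite /kind_at ex Qx; case: ifP => [q|_ /andP[] //].
  by case: (Q_excl Qx q); lia.
have stepE t r : t < n -> prow (st t.+1) r + (u (N - t.+1) == r.+1) = prow (st t) r + (u t == r.+1).
  move=> lt; have ltN : t < N by rewrite /N; lia.
  have := tW t lt; rewrite -lu // /kind_at; case: (boolP (Q t)) => Qt.
    rewrite step_label_up //=; have up := Qpos _ Qt; case/andP=> _ /coversP[_ ->].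
    rewrite (u0 (N - t.+1)); first by lia.
    by apply/negP => q; apply: (Q_excl Qt q); lia.
  case: (boolP (Q (N - t.+1))) => Qt'.
    rewrite step_label_down //=; have up := Qpos _ Qt'; case/andP=> _ /coversP[_ ->].
    by rewrite (u0 t) //; lia.
  by case/andP=> _ /eqP ->; rewrite !u0.
pose P x r := prow (st (minn x (N - x))) r.-1.
have Zz : zigzag N.-1 u (fun x => u (N - x.+1)).
  have stE x r : x < N -> 0 < r -> P x.+1 r + (u (N - x.+1) == r) = P x r + (u x == r).
    move=> lt; case: r => // r _; rewrite /P /=; case: (ltnP x n) => lx.
      have -> : minn x (N - x) = x by rewrite /N; lia.
      have -> : minn x.+1 (N - x.+1) = x.+1 by rewrite /N; lia.
      exact: stepE.
    have -> : minn x (N - x) = (N - x.+1).+1 by move: lx lt; rewrite /N; lia.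
    have -> : minn x.+1 (N - x.+1) = N - x.+1 by move: lx lt; rewrite /N; lia.
    have lt' : N - x.+1 < n by move: lx lt; rewrite /N; lia.
    have := stepE (N - x.+1) r lt'.
    have -> : N - (N - x.+1).+1 = x by lia.
    by [].
  have one x : x < N -> (u x == 0) || (u (N - x.+1) == 0).
    move=> lt; case: (boolP (Q x)) => Qx; last by rewrite u0.
    rewrite (u0 (N - x.+1)) ?eqxx ?orbT //; apply/negP => q; apply: (Q_excl Qx q); lia.
  have NS : N.-1.+1 = N by rewrite prednK // /N; lia.
  have P_mono x r : 0 < r -> P x r.+1 <= P x r by move=> r0; apply: prow_mono; lia.
  (* At each x only one of the two steps changes the partition, so the middle
     one is the smaller of its neighbours. *)
  exists P, (fun x r => minn (P x r) (P x.+1 r)); split.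
  - by move=> r _; rewrite NS /P subnn minn0 min0n /= !prow0.
  - move=> x r lx r0; have lt : x < N by lia.
    by have := stE x r lt r0; have := one x lt; lia.
  - by move=> x r _; apply: P_mono.
  - by move=> x r _ r0; have := P_mono x r r0; have := P_mono x.+1 r r0; lia.
have [X0 [h [v [G0 B0]]]] := zigzag_growth Zz.
have NS : N.-1.+1 = N by rewrite prednK // /N; lia.
rewrite NS in G0.
have hb x : x < N -> h x (N - x.+1) = u x.
  by move=> lt; case: (B0 x) => [|<- _]; [lia | congr h; lia].
have vb x : x < N -> v x (N - x.+1) = u (N - x.+1).
  by move=> lt; case: (B0 x) => [|_ <-]; [lia | congr v; lia].
pose X x y := X0 x y && (x + y + 2 <= N).
have G : growth N X h v.
  case: G0 => g1 g2 g3; split=> // x y lc; have [e1 e2 e3] := g3 x y lc.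
  by rewrite /X lc andbT.
have iX x y : X x y -> x + y + 2 <= N by case/andP.
(* The filling and its transpose have the same boundary labels. *)
have sX x y : X x y = X y x.
  case: (leqP (x + y + 2) N) => lc; last by rewrite /X; lia.
  apply: (growth_boundary_det G (growth_tr G)) => // {lc} {}x {}y exy.
  have ex : y = N - x.+1 by lia.
  have ey : x = N - y.+1 by lia.
  split.
  - by rewrite [in LHS]ex hb 1?[in RHS]ey ?vb -?ey //; lia.
  - by rewrite [in LHS]ex vb 1?[in RHS]ey ?hb -?ex //; lia.
have fX x y y' : X x y -> X x y' -> y = y'.
  have H a b : X x a -> X x b -> a < b -> False.
    move=> Xa Xx2 lt; have [_ _ e1 _] := dot_labels G (iX _ _ Xa) Xa.
    have [e2 _ _ _] := dot_labels G (iX _ _ Xx2) Xx2; have lb := iX _ _ Xx2.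
    by have := h_mono G lt (_ : x + b < N); rewrite e1 e2 => /(_ ltac:(lia)).
  by move=> Xy Xy'; case: (ltngtP y y') => // [/(H _ _ Xy Xy')|/(H _ _ Xy' Xy)].
have dX x y : X x y -> Q x.
  move=> Xxy; apply: contraT => /u0 e; have lc := iX _ _ Xxy.
  have [_ _ e1 _] := dot_labels G lc Xxy.
  have := @h_mono _ _ _ _ G x y.+1 (N - x.+1) ltac:(lia) ltac:(lia).
  by rewrite hb ?e1 ?e //; lia.
have tX x : Q x -> exists y, X x y.
  move=> Qx; have ltN := Q_lt Qx; have up := Qpos _ Qx.
  have [|||z lz bz] := birth_in_col G (r := 0) (x := x) (y := 0) (y' := N - x.+1); try lia.
    by case: (G) => -> // _ _; rewrite hb //; lia.
  by exists z; rewrite -(birth0 G) //; lia.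
have GX := fill_growth sX fX.
have hE x y : x + y < N -> hlab X x y = h x y by move=> lt; case: (growth_det GX G _ lt).
have bE x : x < N -> boundary X x = u x by move=> lt; rewrite /boundary hE ?hb //; lia.
have b0 := boundary_notQ dX.
have bE' x : boundary X x = u x.
  by case: (ltnP x N) => lx; [exact: bE | rewrite b0 ?u0 //; apply/negP => /Q_lt; lia].
have lblE t : t < n -> step_label (boundary X) t = lab t by move=> lt;
  rewrite /step_label !bE' -/(step_label u t) lu.
have F : filling X.
  split => //; apply/(peaks_boundary sX fX dX iX tX)/(peaks_labels_ok b0) => t lt.
  by rewrite !lblE //; [exact: cW | lia].
have rlE t r : t <= n -> rowlen (hlab X) r.+1 t (N - t) = prow (st t) r.
  elim: t => [|t IH] lt; first by rewrite /rowlen big_ord0 prow0.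
  have := rowlen_step F (lt : t < n) (isT : 0 < r.+1); rewrite IH; last lia.
  by have := stepE t r lt; rewrite !bE'; lia.
have BX : in_box X.
  apply/in_boxP; split=> [x lt|t lt]; last by rewrite rlE // prow_le.
  rewrite bE' /u; case: ifP => // _; rewrite /lab.
  by case: ifP => _; rewrite -ltnS ltn_ord.
exists X; split=> //; apply: (@eq_from_nth _ walk_start); rewrite ?size_mkseq // => t lt.
rewrite !nth_mkseq // /walk_step lblE // [RHS]surjective_pairing; congr pair.
  by apply/val_inj; rewrite /= inordK // ltn_ord.
by apply: prow_inj => i; rewrite prow_walk_state // rlE.
Qed.

Definition walks := [set w : (size kinds).-tuple ('I_R.+1 * bpart R C)%type | is_walk w].

(** The fillings are functions on all pairs of numbers; they are counted through
a finite set A that encodes them. *)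
Lemma card_fillings (S : finType) (A : {set S}) (enc : S -> nat -> nat -> bool) : 0 < n ->
  {in A, forall a, filling (enc a)} ->
  {in A &, forall a b, (forall x y, enc a x y = enc b x y) -> a = b} ->
  (forall X, filling X -> exists2 a, a \in A & forall x y, enc a x y = X x y) ->
  #|[set a in A | in_box (enc a)]| = #|walks|.
Proof.
move=> n0 Af Ai As.
have psize a : size (walk (enc a)) == size kinds by rewrite !size_mkseq.
pose f a : (size kinds).-tuple ('I_R.+1 * bpart R C)%type := Tuple (psize a).
rewrite -(card_in_imset (f := f)).
  congr #|pred_of_set _|; apply/setP => w; rewrite inE; apply/imsetP/idP.
    by case=> a; rewrite inE => /andP[aA Ba] ->; apply: walk_is_walk => //; apply: Af.
  move=> Ww; have [|X [F B e]] := @walk_surj w n0 _ Ww; first by rewrite size_tuple size_mkseq.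
  have [a aA ea] := As X F.
  have eh x y : hlab (enc a) x y = hlab X x y.
    have ga := fill_growth_at (fill_sym (Af a aA)) (fill_fun (Af a aA)).
    have gX := fill_growth_at (fill_sym F) (fill_fun F).
    by case: (growth_det (ga _) (gX _) (fun x y _ => ea x y) (leqnn (x + y).+1)).
  have eB x : boundary (enc a) x = boundary X x by exact: eh.
  have er r x y : rowlen (hlab (enc a)) r x y = rowlen (hlab X) r x y.
    by apply: eq_bigr => i _; rewrite eh.
  exists a.
    rewrite inE aA; case/in_boxP: B => B1 B2; apply/in_boxP.
    by split=> [x lx|t lt]; rewrite ?eB ?er; [apply: B1 | apply: B2].
  apply: val_inj; rewrite /= -e; apply: eq_mkseq => t;
    rewrite /walk_step /walk_state /step_label !eB; congr pair.
  by congr insubd; apply/ffunP => i; rewrite !ffunE er.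
move=> a b; rewrite !inE => /andP[aA Ba] /andP[bA Bb] e; apply: Ai => //.
by apply: (walk_inj (Af a aA) (Af b bA) Ba Bb); have := congr1 val e.
Qed.
End Box.

Lemma card_walks_conj R C : #|walks R C| = #|walks C R|.
Proof.
have E R' C' : (#|walks R' C'|%:R = nwalk kinds (None, walk_start R' C') :> int)%R.
  by rewrite nwalk_card; congr (_%:R)%R; apply: eq_card => w; rewrite !inE.
apply/eqP; rewrite -(Num.Theory.eqr_nat int) !E nwalk_conj ?conj_part0 //.
exact: kinds_runs.
Qed.

Theorem card_fillings_conj (S : finType) (A : {set S}) (enc : S -> nat -> nat ->
  bool) R C : 0 < n ->
  {in A, forall a, filling (enc a)} ->
  {in A &, forall a b, (forall x y, enc a x y = enc b x y) -> a = b} ->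
  (forall X, filling X -> exists2 a, a \in A & forall x y, enc a x y = X x y) ->
  #|[set a in A | in_box R C (enc a)]| = #|[set a in A | in_box C R (enc a)]|.
Proof.
by move=> n0 Af Ai As; rewrite !(card_fillings _ _ n0 Af Ai As) card_walks_conj.
Qed.

(** The number of columns is never more than N, so only the labels are
restricted. *)
Lemma in_box_dec k X : filling X -> reflect
  (forall a b s, a + b + 2 <= N -> size s = k.+1 -> sorted goes_se s ->
     ~~ all (fun p => [&& X p.1 p.2, p.1 <= a & p.2 <= b]) s)
  (in_box k N X).
Proof.
case=> sX fX dX iX _ _; have G := fill_growth sX fX.
apply: (iffP idP) => [/in_boxP[b1 _] a b s lc ss so|H].
  apply/negP => al.
  have : [exists x : 'I_N, k < hlab X x (N - x.+1)] by apply/(dec_chainP G); exists a, b, s.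
  by case/existsP=> x; have := b1 x (ltn_ord x); rewrite /boundary; lia.
apply/in_boxP; split=> [x lx|t lt]; last first.
  by apply: leq_trans (rowlen_le _ _ _ _) _; rewrite /N; lia.
rewrite leqNgt; apply/negP => lt.
have : [exists x : 'I_N, k < hlab X x (N - x.+1)] by apply/existsP; exists (Ordinal lx).
by case/(dec_chainP G) => a [b [s [lc ss so al]]]; move/negP: (H a b s lc ss so).
Qed.

(** No label exceeds N, so only the first rows are restricted. *)
Lemma in_box_inc k X : filling X -> reflect
  (forall s, size s = k.+1 -> sorted goes_sw s -> ~~ all (fun p => X p.1 p.2) s)
  (in_box N k X).
Proof.
case=> sX fX dX iX _ _; have G := fill_growth sX fX.
apply: (iffP idP) => [/in_boxP[_ b2] s ss so|H].
  apply/negP => al.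
  have : [exists t : 'I_N.+1, k < rowlen (hlab X) 1 t (N - t)] by apply/(inc_chainP G) => //;
    exists s.
  case/existsP=> -[t ltt] /=; case: (leqP t n) => le; first by have := b2 t le; lia.
  rewrite (rowlen_sym G sX) //; last lia.
  have lt2 : N - t <= n by rewrite /N; lia.
  have e2 : N - (N - t) = t by lia.
  by have := b2 _ lt2; rewrite e2; lia.
apply/in_boxP; split=> [x lx|t lt].
  by apply: leq_trans (h_le G _) _; lia.
rewrite leqNgt; apply/negP => ltk; have ltt : t < N.+1 by rewrite /N; lia.
have : [exists t : 'I_N.+1, k < rowlen (hlab X) 1 t (N - t)] by apply/existsP; exists (Ordinal ltt).
by case/(inc_chainP G) => // s [ss so al]; move/negP: (H s ss so).
Qed.
End Fill.

(** * Occurrences to the north-east of a cell *)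

Lemma involutionP n (s : 'S_n) : reflect (forall i, s (s i) = i) (involution s).
Proof.
apply: (iffP eqP) => [e i|H]; first by rewrite {2}e permKV.
by apply/permP => i; apply: (perm_inj (s := s)); rewrite H permKV.
Qed.

Lemma occurrenceP m n (p : 'S_m) (s : 'S_n) (f : {ffun 'I_m -> 'I_n}) : reflect
  ((forall i j : 'I_m, i < j -> f i < f j) /\ (forall i j : 'I_m, (s (f i) < s (f j)) =
    (p i < p j)))
  (occurrence p s f).
Proof.
apply: (iffP andP) => [[/forallP H1 /forallP H2]|[H1 H2]]; split.
- by move=> i j; move/forallP/(_ j)/implyP: (H1 i).
- by move=> i j; move/forallP/(_ j)/eqP: (H2 i).
- by apply/forallP => i; apply/forallP => j; apply/implyP; exact: H1.
- by apply/forallP => i; apply/forallP => j; apply/eqP; exact: H2.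
Qed.

Lemma occ_mono m n (p : 'S_m) (s : 'S_n) (f : {ffun 'I_m -> 'I_n}) : occurrence p s f ->
  forall i j : 'I_m, (f i < f j) = (i < j).
Proof.
case/occurrenceP=> H _ i j; case: (ltngtP i j) => [/H//|/H|/val_inj ->]; [lia | by rewrite ltnn].
Qed.

(** Transposing the permutation matrix of an involution. *)
Lemma occ_inv m n (p : 'S_m) (s : 'S_n) (f : {ffun 'I_m -> 'I_n}) : involution s ->
  occurrence p s f ->
  occurrence p^-1%g s [ffun a => s (f (p^-1%g a))].
Proof.
move=> /involutionP iv oc; have mono := occ_mono oc; case/occurrenceP: oc => H1 H2.
by apply/occurrenceP; split=> i j; rewrite !ffunE ?H2 ?permKV // !iv mono.
Qed.

Section Inside.
Variables (m n : nat) (tau : 'S_m).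
Implicit Types (s : 'S_n).

Definition occ_ne (p : 'S_m) s (i j : nat) := [exists g : {ffun 'I_m -> 'I_n},
  occurrence p s g && [forall a, (i < g a) && (j < s (g a))]].

Lemma occ_neP p s i j : reflect (exists g : {ffun 'I_m ->
  'I_n}, occurrence p s g /\ forall a, i < g a /\ j < s (g a)) (occ_ne p s i j).
Proof.
apply: (iffP existsP) => [[g /andP[oc /forallP H]]|[g [oc H]]]; exists g.
  by split=> // a; apply/andP.
by rewrite oc; apply/forallP => a; apply/andP.
Qed.

Lemma occ_ne_inv p s i j : involution s -> occ_ne p s i j -> occ_ne p^-1%g s j i.
Proof.
move=> iv /occ_neP[g [oc H]]; apply/occ_neP; exists [ffun a => s (g (p^-1%g a))].
split; first exact: occ_inv.
by move=> a; rewrite ffunE; case: (H (p^-1%g a)) => ? ?; rewrite (involutionP _ iv).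
Qed.

(** The inverse of tau is included to make the shape of the inner cells
symmetric; for an involution it does not affect which patterns p (+) tau with an
involution p occur, because the whole pattern can be transposed. *)
Definition inside s (i j : nat) := occ_ne tau s i j || occ_ne tau^-1%g s i j.

Lemma insideP s i j : reflect (exists2 p, p = tau \/ p = tau^-1%g & occ_ne p s i j) (inside s i j).
Proof.
apply: (iffP orP) => [[oc|oc]|[p [->|->] oc]];
  [exists tau | exists tau^-1%g | left | right] => //; by [left|right].
Qed.

Lemma inside_sym s i j : involution s -> inside s i j = inside s j i.
Proof.
move=> iv; apply/orP/orP => -[] /(occ_ne_inv iv); rewrite ?invgK; by [left | right].
Qed.

Lemma inside_down s i j i' j' : inside s i j -> i' <= i -> j' <= j -> inside s i' j'.
Proof.
case/insideP=> p hp /occ_neP[g [oc H]] li lj; apply/insideP; exists p => //.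
by apply/occ_neP; exists g; split => // a; case: (H a); lia.
Qed.

Lemma inside_lt s i j : 0 < m -> inside s i j -> i.+1 < n /\ j.+1 < n.
Proof.
move=> m_gt0 /insideP[p hp /occ_neP[g [oc H]]].
have [l1 l2] := H (Ordinal m_gt0); have := ltn_ord (g (Ordinal m_gt0));
  have := ltn_ord (s (g (Ordinal m_gt0))).
by lia.
Qed.

(** An occurrence to the north-east of (i, j) that avoids column i + 1 is also
one to the north-east of (i + 1, j). *)
Lemma inside_jump s (i1 : 'I_n) i j : inside s i j -> ~~ inside s i1 j -> i1 = i.+1 :> nat ->
  j < s i1.
Proof.
move=> /insideP[p hp /occ_neP[g [oc H]]] ni e; rewrite ltnNge; apply/negP => le; case/negP: ni.
apply/insideP; exists p => //; apply/occ_neP; exists g; split=> // a; have [l1 l2] := H a;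
  split=> //.
rewrite e ltn_neqAle l1 andbT; apply/eqP => ea; have ga : i1 = g a by apply/val_inj; rewrite /= e.
by move: l2; rewrite -ga; lia.
Qed.

(** An occurrence with a dot in an inner cell can be replaced by one to the
north-east of that dot, so after finitely many steps only outer dots are used,
and these belong to both permutations. *)
Lemma inside_sub s s' : (forall i : 'I_n, ~~ inside s i (s i) -> s' i = s i) ->
  forall i j, inside s i j -> inside s' i j.
Proof.
move=> eqo i j; have [k] := ubnP (n - i); elim: k i j => // k IH i j lk ins.
have [p hp /occ_neP[g [oc H]]] := insideP _ _ _ ins.
case: (boolP [exists a, inside s (g a) (s (g a))]) => [/existsP[a ia]|].
  have [l1 l2] := H a; have ltg := ltn_ord (g a).
  have := IH _ _ _ ia; move=> /(_ ltac:(lia)) ia'.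
  by apply: inside_down ia' _ _; lia.
rewrite negb_exists => /forallP no; apply/insideP; exists p => //; apply/occ_neP; exists g.
have eg a : s' (g a) = s (g a) by apply: eqo.
split; last by move=> a; rewrite eg.
by case/occurrenceP: oc => H1 H2; apply/occurrenceP; split=> // a b; rewrite !eg.
Qed.

Lemma inside_eq s s' : (forall i : 'I_n, ~~ inside s i (s i) -> s' i = s i) ->
  (forall i : 'I_n, inside s i (s i) -> inside s i (s' i)) ->
  forall i j, inside s' i j = inside s i j.
Proof.
move=> H1 H2; have S := inside_sub H1 => i j; apply/idP/idP; last exact: S.
apply: inside_sub => {}i no; case: (boolP (inside s i (s i))) => [ins|/H1 //].
by case/negP: no; apply: S; apply: H2.
Qed.

Lemma dsum_l k (p : 'S_k) a : dsum p tau (lshift m a) = lshift m (p a).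
Proof. by rewrite permE /dsum_fun -/(unsplit (inl a)) unsplitK. Qed.

Lemma dsum_r k (p : 'S_k) b : dsum p tau (rshift k b) = rshift k (tau b).
Proof. by rewrite permE /dsum_fun -/(unsplit (inr b)) unsplitK. Qed.

Lemma contains_dsum_occ k (p : 'S_k) s (f : {ffun 'I_k -> 'I_n}) i j : occurrence p s f ->
  (forall a, f a <= i /\ s (f a) <= j) -> occ_ne tau s i j -> contains s (dsum p tau).
Proof.
move=> /occurrenceP[f1 f2] B /occ_neP[g [/occurrenceP[g1 g2] H]].
apply/existsP; exists [ffun x => match split x with inl a => f a | inr b => g b end].
apply/occurrenceP; split=> x y; rewrite !ffunE -[x]splitK -[y]splitK; case: (split x) => a;
  case: (split y) => b;
  rewrite !unsplitK /unsplit ?dsum_l ?dsum_r /=.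
- exact: f1.
- by case: (B a) (H b); lia.
- by have := ltn_ord b; lia.
- by rewrite ltn_add2l; exact: g1.
- exact: f2.
- by case: (B a) (H b); have := ltn_ord (p a); lia.
- by case: (B b) (H a); have := ltn_ord (p b); lia.
- by rewrite ltn_add2l; exact: g2.
Qed.

(** An occurrence of the inverse of tau is turned into one of tau by transposing
it together with the occurrence of p, which is its own inverse. *)
Lemma containsP k (p : 'S_k) s : 0 < k -> involution s -> p^-1%g = p -> reflect
  (exists (f : {ffun 'I_k -> 'I_n}) i j, [/\ occurrence p s f, forall a, f a <= i /\
    s (f a) <= j & inside s i j])
  (contains s (dsum p tau)).
Proof.
case: k p => // k p _ iv ip; apply: (iffP existsP) => [[h oc]|[f [i [j [oc B]]]]].
  have mono := occ_mono oc; case/occurrenceP: oc => h1 h2.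
  pose f := [ffun a => h (lshift m a)]; pose g := [ffun b => h (rshift k.+1 b)].
  have oc : occurrence p s f.
    apply/occurrenceP; split=> a b; rewrite !ffunE; first by rewrite mono.
    by rewrite h2 !dsum_l.
  have og : occurrence tau s g.
    apply/occurrenceP; split=> a b; rewrite !ffunE; first by rewrite mono /= ltn_add2l.
    by rewrite h2 !dsum_r /= ltn_add2l.
  (* The corner is the last position and the largest value of the occurrence of
     p. *)
  exists f, (f ord_max), (s (f (p^-1%g ord_max))); split=> //.
    move=> a; split; rewrite leqNgt ?(occ_mono oc).
      by rewrite -leqNgt -ltnS ltn_ord.
    by case/occurrenceP: oc => _ ->; rewrite permKV -leqNgt -ltnS ltn_ord.
  apply/insideP; exists tau; first by left.
  apply/occ_neP; exists g; split=> // a; rewrite !ffunE; split.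
    by rewrite mono /=; lia.
  by rewrite h2 dsum_l dsum_r permKV /=; lia.
case/orP => ne; first exact/existsP/(contains_dsum_occ oc B ne).
have oc' := occ_inv iv oc; rewrite ip in oc'.
have ne' := occ_ne_inv iv ne; rewrite invgK in ne'.
apply/existsP/(contains_dsum_occ oc' _ ne') => a.
by rewrite ffunE (involutionP _ iv); case: (B (p a)).
Qed.
End Inside.

(** * Classes of alternating involutions *)

Definition alt_at n (s : 'S_n) (i j : 'I_n) := if odd i then s j < s i else s i < s j.

Lemma alternatingP n (s : 'S_n) : reflect (forall i j : 'I_n, j = i.+1 :> nat ->
  alt_at s i j) (alternating s).
Proof.
apply: (iffP forallP) => [H i j e|H i].
  by move/forallP/(_ j)/implyP: (H i); apply; apply/eqP.
by apply/forallP => j; apply/implyP => /eqP; apply: H.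
Qed.

Section Class.
Variables (m n : nat) (tau : 'S_m).
Hypothesis m_gt0 : 0 < m.
Notation ins := (inside tau).

(** The shape of the inner cells, and the dots outside it. *)
Definition outer_data (s : 'S_n) : {set 'I_n * 'I_n} * {set 'I_n * 'I_n} :=
  ([set p : 'I_n * 'I_n | ins s p.1 p.2], [set p : 'I_n * 'I_n | (s p.1 == p.2) &&
    ~~ ins s p.1 p.2]).

Variable s0 : 'S_n.
Hypothesis s0_alt : alternating s0.
Hypothesis s0_inv : involution s0.
Notation L := (ins s0).
Notation N := (n + n).

Let s0K i : s0 (s0 i) = i. Proof. exact: involutionP. Qed.
Let L_sym i j : L i j = L j i. Proof. exact: inside_sym. Qed.
Let L_down i j i' j' : L i j -> i' <= i -> j' <= j -> L i' j'. Proof. exact: inside_down. Qed.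
Let L_lt i j : L i j -> i.+1 < n /\ j.+1 < n. Proof. exact: inside_lt. Qed.

Definition inner (i : 'I_n) := L i (s0 i).
Definition height i := \sum_(j < n) L i j.

Lemma heightP i j : (j < height i) = L i j.
Proof.
rewrite /height (sum_initial (P := fun j => L i j)); last by move=> a b le; move/L_down; apply.
by case: (ltnP j n) => //= le; apply/esym/negP => /L_lt[]; lia.
Qed.

Lemma height_sym i j : (j < height i) = (i < height j). Proof. by rewrite !heightP L_sym. Qed.

Lemma height_mono i i' : i <= i' -> height i' <= height i.
Proof.
by move=> le; rewrite leqNgt; apply/negP; rewrite heightP => /L_down/(_ le (leqnn _));
  rewrite -heightP ltnn.
Qed.

Lemma height_le i : height i <= n.
Proof. by rewrite leqNgt; apply/negP; rewrite heightP => /L_lt[]; lia. Qed.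

(** The time at which the path along the boundary of the shape, from (0, n) to
(n, 0), traverses column i.  Row j is traversed at time 2n - 1 - [col_time j],
so that a cell is inner iff its column comes before its row, that is iff the two
times of its coordinates add up to at most 2n - 2. *)
Definition col_time i := i + n - height i.

Lemma col_time_lt i j : i < j -> col_time i < col_time j.
Proof. by move=> lt; rewrite /col_time; have := height_mono (ltnW lt); have := height_le i;
  have := height_le j; lia. Qed.

Lemma col_time_ltE i j : (col_time i < col_time j) = (i < j).
Proof. by case: (ltngtP i j) => [/col_time_lt//|/col_time_lt|->]; [lia | rewrite ltnn]. Qed.

Lemma col_time_inj i j : col_time i = col_time j -> i = j.
Proof. by case: (ltngtP i j) => // /col_time_lt; lia. Qed.

Lemma col_time_le i j : (col_time i <= col_time j) = (i <= j).
Proof. by rewrite leqNgt col_time_ltE -leqNgt. Qed.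

Lemma col_time_in i j : (col_time i + col_time j + 2 <= N) = L i j.
Proof.
rewrite -heightP /col_time; have := height_sym i j; have := height_le i; have := height_le j.
by case: (ltnP j (height i)) => a; case: (ltnP i (height j)) => b //; lia.
Qed.

Lemma col_time_excl i j : col_time i + col_time j + 1 <> N.
Proof.
rewrite /col_time; have := height_sym i j; have := height_le i; have := height_le j.
by case: (ltnP j (height i)) => a; case: (ltnP i (height j)) => b //; lia.
Qed.

Lemma inner_s0 i : inner (s0 i) = inner i.
Proof. by rewrite /inner s0K L_sym. Qed.

Lemma jump (i i1 : 'I_n) j : i1 = i.+1 :> nat -> L i j -> ~~ L i1 j -> j < s0 i1.
Proof. by move=> e l nl; apply: (inside_jump l nl e). Qed.

(** Where the height drops the next dot lies above the drop ([jump]), hence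
above the inner dot before it.  Around an inner peak the dots go up and then
down: on the left a drop would put the peak above the shape, on the right it
would make the next valley higher than the peak. *)
Lemma peak_nbr (i : 'I_n) : inner i -> odd i -> exists i1 i2 : 'I_n,
  [/\ i = i1.+1 :> nat, i2 = i.+1 :> nat, inner i1 /\ inner i2, col_time i = (col_time i1).+1 &
    col_time i2 = (col_time i).+1].
Proof.
move=> Ci oi; have [l1 _] := L_lt Ci.
have p1 : i.-1 < n by have := ltn_ord i; lia.
pose i1 := Ordinal p1; pose i2 := Ordinal l1.
have e1 : i = i1.+1 :> nat by rewrite /=; case: (i : nat) oi.
have := alternatingP _ s0_alt i1 i e1; have := alternatingP _ s0_alt i i2 (erefl _).
rewrite /alt_at oi; have -> : odd i1 = false by move: oi; rewrite e1 /=; case: odd.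
move=> d a.
have C1 : inner i1 by apply: (L_down Ci); rewrite /=; lia.
have hle1 := height_mono (leq_pred i : i1 <= i); have hle2 := height_mono (leqnSn i : i <= i2).
have hi : s0 i < height i by rewrite heightP.
have h1 : height i1 = height i.
  apply/eqP; rewrite eqn_leq hle1 andbT leqNgt; apply/negP => lt.
  have := jump e1 (j := (height i)); rewrite -!heightP ltnn lt => /(_ isT isT); lia.
have h2 : height i2 = height i.
  apply/eqP; rewrite eqn_leq hle2 /= leqNgt; apply/negP => lt.
  have := jump (i1 := i2) (i := i) (erefl _) (j := (height i2));
    rewrite -!heightP ltnn lt => /(_ isT isT).
  by have := jump (i1 := i2) (i := i) (erefl _) (j := (height i).-1); rewrite -!heightP; lia.
have C2 : inner i2 by rewrite /inner -heightP h2; lia.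
exists i1, i2; split => //; rewrite /col_time ?h1 ?h2; have := height_le i; rewrite /=; lia.
Qed.

Definition inner_time x := [exists i : 'I_n, inner i && (col_time i == x)].
Definition peak_time x := [exists i : 'I_n, [&& inner i, odd i & col_time i == x]].

Lemma inner_timeP x : reflect (exists2 i : 'I_n, inner i & col_time i = x) (inner_time x).
Proof.
apply: (iffP existsP) => [[i /andP[Ci /eqP e]]|[i Ci e]]; exists i => //.
by rewrite Ci e eqxx.
Qed.

Lemma peak_timeP x : reflect (exists i : 'I_n, [/\ inner i, odd i & col_time i = x]) (peak_time x).
Proof.
apply: (iffP existsP) => [[i /and3P[Ci oi /eqP e]]|[i [Ci oi e]]]; exists i => //.
by rewrite Ci oi e eqxx.
Qed.

Lemma inner_time_col (i : 'I_n) : inner_time (col_time i) = inner i.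
Proof. by apply/inner_timeP/idP => [[j Cj /col_time_inj/val_inj <-]|Ci] //; exists i. Qed.

Lemma inner_time_lt x : inner_time x -> x < N.
Proof.
case/inner_timeP=> i Ci <-; have := ltn_ord i; have : s0 i < height i by rewrite heightP.
by rewrite /col_time; lia.
Qed.

Lemma inner_time_excl x y : inner_time x -> inner_time y -> x + y + 1 <> N.
Proof. by case/inner_timeP=> i _ <- /inner_timeP[j _ <-]; exact: col_time_excl. Qed.

Lemma peak_time_nbr x : peak_time x -> [/\ 0 < x, inner_time x.-1, inner_time x & inner_time x.+1].
Proof.
case/peak_timeP=> i [Ci oi <-]; have [i1 [i2 [e1 e2 [C1 C2] c1 c2]]] := peak_nbr Ci oi.
by split; rewrite -?c2 ?inner_time_col // c1 //= inner_time_col.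
Qed.

Lemma peak_time_next x : peak_time x -> ~~ peak_time x.+1.
Proof.
case/peak_timeP=> i [Ci oi <-]; have [i1 [i2 [e1 e2 [C1 C2] c1 c2]]] := peak_nbr Ci oi.
apply/negP => /peak_timeP[j [Cj oj]]; rewrite -c2 => /col_time_inj ej.
by move: oj; rewrite ej e2 /= oi.
Qed.

Definition outer_class : {set 'S_n} := [set s in AI n | outer_data s == outer_data s0].

(** For two neighbours which are not both inner, the order of the dots is
forced: an outer dot lies above an inner one next to it, by [jump] when the
height drops in between. *)
Lemma outer_classP s : reflect [/\ involution s, (forall i, ~~ inner i ->
  s i = s0 i), (forall i, inner i -> L i (s i)) &
   forall i j : 'I_n, j = i.+1 :> nat -> inner i -> inner j -> alt_at s i j] (s \in outer_class).
Proof.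
rewrite !inE; apply: (iffP andP) => [[/andP[al iv] /eqP[eL eO]]|[iv so si sa]].
  have hL (i j : 'I_n) : ins s i j = L i j.
    by have := congr1 (fun A : {set 'I_n * 'I_n} => (i, j) \in A) eL; rewrite !inE.
  have hO (i j : 'I_n) : (s i == j) && ~~ ins s i j = (s0 i == j) && ~~ L i j.
    by have := congr1 (fun A : {set 'I_n * 'I_n} => (i, j) \in A) eO; rewrite !inE.
  split=> // [i nC|i Ci|i j e _ _]; last exact: alternatingP.
    by have := hO i (s0 i); rewrite eqxx nC => /andP[/eqP].
  rewrite -hL; apply: contraT => no; have := hO i (s i); rewrite eqxx no => /esym/andP[/eqP e].
  by rewrite -e -/(inner i) Ci.
have hL i j : ins s i j = L i j by exact: inside_eq.
split; last first.
  apply/eqP; congr pair; apply/setP => -[i j]; rewrite !inE /= ?hL //.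
  case: (boolP (L i j)) => l; rewrite ?andbF ?andbT //.
  case: (boolP (inner i)) => Ci; last by rewrite so.
  by apply/eqP/eqP => e; [have := si _ Ci | have := Ci; rewrite /inner]; rewrite e (negPf l).
rewrite iv andbT; apply/alternatingP => i j e.
have a0 := alternatingP _ s0_alt i j e.
have nin t : t \in [:: s; s0] -> forall a, ~~ inner a -> ~~ L a (t a).
  by rewrite !inE => /orP[/eqP ->|/eqP ->] a Ca //; rewrite so.
have inn t : t \in [:: s; s0] -> forall a, inner a -> L a (t a).
  by rewrite !inE => /orP[/eqP ->|/eqP ->] a Ca //; apply: si.
case: (boolP (inner i)) => Ci; case: (boolP (inner j)) => Cj; first exact: sa.
- have up t : t \in [:: s; s0] -> t i < t j.
    move=> height; have li := inn t height _ Ci; have nj := nin t height _ Cj.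
    have etj : t j = s0 j by move: height; rewrite !inE => /orP[/eqP ->|/eqP ->] //; apply: so.
    case: (boolP (L j (t i))) => lj; last by rewrite etj; apply: jump e li lj.
    by rewrite ltnNge; apply/negP => le; case/negP: nj; apply: L_down lj _ le.
  have := up s0; have := up s; rewrite !inE !eqxx orbT => /(_ isT) u1 /(_ isT) u2.
  by move: a0; rewrite /alt_at; case: ifP => // _; lia.
- have dn t : t \in [:: s; s0] -> t j < t i.
    move=> height; have li := inn t height _ Cj; have nj := nin t height _ Ci.
    by rewrite ltnNge; apply/negP => le; case/negP: nj; apply: L_down li _ le; lia.
  have := dn s0; have := dn s; rewrite !inE !eqxx orbT => /(_ isT) u1 /(_ isT) u2.
  by move: a0; rewrite /alt_at; case: ifP => // _; lia.
- by rewrite /alt_at !so.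
Qed.

(** The times embed the shape into the staircase of size 2n; rows and columns
without inner dots stay empty. *)
Definition to_filling (s : 'S_n) x y :=
  [exists i : 'I_n, [&& inner i, col_time i == x & col_time (s i) == y]].
Lemma to_fillingP (s : 'S_n) x y : reflect (exists i : 'I_n, [/\ inner i, col_time i = x &
  col_time (s i) = y]) (to_filling s x y).
Proof.
apply: (iffP existsP) => [[i /and3P[Ci /eqP e /eqP e']]|[i [Ci e e']]]; exists i => //.
by rewrite Ci e e' !eqxx.
Qed.

Lemma outer_class_inner s : s \in outer_class -> forall i, inner (s i) = inner i.
Proof.
case/outer_classP=> /involutionP iv so si _ i.
have H a : inner a -> inner (s a).
  by move=> Ca; apply: contraT => nC; have := so _ nC; rewrite iv => e;
    rewrite -inner_s0 -e Ca in nC.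
by apply/idP/idP => [/H|/H//]; rewrite iv.
Qed.

Lemma to_fillingE s : s \in outer_class -> filling n inner_time peak_time (to_filling s).
Proof.
move=> sA; have sC := outer_class_inner sA;
  have [/involutionP iv so si sa] := outer_classP _ sA; split.
- have H x y : to_filling s x y -> to_filling s y x.
    by case/to_fillingP=> i [Ci e e']; apply/to_fillingP; exists (s i); rewrite sC iv.
  by move=> x y; apply/idP/idP => /H.
- by move=> x y y' /to_fillingP[i [Ci <- <-]] /to_fillingP[j [Cj /col_time_inj/val_inj -> <-]].
- by move=> x y /to_fillingP[i [Ci <- _]]; rewrite inner_time_col.
- by move=> x y /to_fillingP[i [Ci <- <-]]; rewrite col_time_in si.
- by move=> x /inner_timeP[i Ci <-]; exists (col_time (s i)); apply/to_fillingP; exists i.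
- move=> x e f g /peak_timeP[i [Ci oi <-]] X1 X2 X3.
  have [i1 [i2 [e1 e2 [C1 C2] c1 c2]]] := peak_nbr Ci oi.
  rewrite c1 /= in X1; rewrite -c2 in X3.
  case/to_fillingP: X1 => j1 [_ /col_time_inj/val_inj -> <-].
  case/to_fillingP: X2 => j [_ /col_time_inj/val_inj -> <-].
  case/to_fillingP: X3 => j2 [_ /col_time_inj/val_inj -> <-].
  rewrite !col_time_ltE; have := sa i1 i e1 C1 Ci; have := sa i i2 e2 Ci C2; rewrite /alt_at oi.
  by have -> : odd i1 = false by move: oi; rewrite e1 /=; case: odd.
Qed.

Lemma to_filling_inj : {in outer_class &, forall a b, (forall x y, to_filling a x y =
  to_filling b x y) -> a = b}.
Proof.
move=> a b /outer_classP[_ ao ai _] /outer_classP[_ bo bi _] e; apply/permP => i.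
case: (boolP (inner i)) => Ci; last by rewrite ao ?bo.
have : to_filling a (col_time i) (col_time (a i)) by apply/to_fillingP; exists i.
by rewrite e => /to_fillingP[j [_ /col_time_inj/val_inj -> /col_time_inj/val_inj]].
Qed.

Lemma to_filling_surj X : filling n inner_time peak_time X ->
  exists2 s, s \in outer_class & forall x y, to_filling s x y = X x y.
Proof.
case=> sX fX dX iX tX pX.
pose f i := if inner i then odflt i [pick j : 'I_n | X (col_time i) (col_time j)] else s0 i.
have ex i : inner i -> exists2 j : 'I_n, inner j & X (col_time i) (col_time j).
  rewrite -inner_time_col => /tX[y Xy]; move: (Xy); rewrite sX => /dX/inner_timeP[j Cj ej].
  by exists j => //; rewrite ej.
have fin i : inner i -> X (col_time i) (col_time (f i)).
  by move=> Ci; rewrite /f Ci; case: pickP => //= no; have [j _] := ex _ Ci; rewrite no.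
have fC i : inner i -> inner (f i) by move=> Ci; rewrite -inner_time_col;
  apply: (dX _ (col_time i)); rewrite sX fin.
have fK : involutive f.
  move=> i; case: (boolP (inner i)) => Ci; last by rewrite /f (negPf Ci) inner_s0 (negPf Ci) s0K.
  have X1 := fin _ Ci; have X2 := fin _ (fC _ Ci); rewrite sX in X1.
  exact/val_inj/col_time_inj/(fX _ _ _ X2 X1).
pose s := perm (inv_inj fK).
have sE i : s i = f i by rewrite permE.
have encE x y : to_filling s x y = X x y.
  apply/to_fillingP/idP => [[i [Ci <- <-]]|Xxy]; first by rewrite sE fin.
  have /inner_timeP[i Ci ei] := dX _ _ Xxy; exists i; split=> //; rewrite sE.
  by have := fin _ Ci; rewrite ei => X1; apply: fX X1 Xxy.
exists s => //; apply/outer_classP; split.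
- by apply/involutionP => i; rewrite !sE fK.
- by move=> i nC; rewrite sE /f (negPf nC).
- by move=> i Ci; rewrite -col_time_in sE; apply: iX; exact: fin.
move=> i j e Ci Cj; rewrite /alt_at; case: ifP => [oi|noi].
  have [i1 [i2 [e1 e2 [C1 C2] c1 c2]]] := peak_nbr Ci oi.
  have ej : j = i2 by apply/val_inj; rewrite /= e e2.
  have P : peak_time (col_time i) by apply/peak_timeP; exists i.
  have := pX _ (col_time (f i1)) (col_time (f i)) (col_time (f j)) P;
    rewrite {1}c1 /= -c2 -ej !fin // !col_time_ltE !sE.
  by case.
have oj : odd j by rewrite e /= noi.
have [i1 [i2 [e1 e2 [C1 C2] c1 c2]]] := peak_nbr Cj oj.
have ei : i = i1 by apply/val_inj/eqP; rewrite /= -eqSS -e e1.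
have P : peak_time (col_time j) by apply/peak_timeP; exists j.
have := pX _ (col_time (f i)) (col_time (f j)) (col_time (f i2)) P;
  rewrite {1}c1 /= -c2 -ei !fin ?ei // !col_time_ltE !sE -?ei.
by case.
Qed.

Lemma outer_class_inside s : s \in outer_class -> forall i j, ins s i j = L i j.
Proof. by case/outer_classP=> _ so si _; apply: inside_eq. Qed.

Lemma points_of_list s (l : seq (nat * nat)) k : size l = k.+1 ->
  all (fun p => to_filling s p.1 p.2) l ->
  exists f : 'I_k.+1 -> 'I_n, forall a : 'I_k.+1, nth (0, 0) l a = (col_time (f a),
    col_time (s (f a))).
Proof.
move=> sl al; have H (a : 'I_k.+1) : exists i : 'I_n, nth (0, 0) l a = (col_time i, col_time (s i)).
  have al' : nth (0, 0) l a \in l by rewrite mem_nth // sl.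
  have /to_fillingP[i [_ e1 e2]] := allP al _ al'.
  by exists i; rewrite e1 e2 -surjective_pairing.
by case: (fin_all_exists H) => f; exists f.
Qed.

(** For an increasing pattern the corner of the rectangle is the last dot. *)
Lemma contains_incr s k : s \in outer_class ->
  contains s (dsum (incr_perm k.+1) tau) = ~~ in_box n N k (to_filling s).
Proof.
move=> sA; have F := to_fillingE sA; have [iv so si sa] := outer_classP _ sA.
have hL := outer_class_inside sA.
have ip : (incr_perm k.+1)^-1%g = incr_perm k.+1 by rewrite invg1.
have pE i : incr_perm k.+1 i = i by rewrite perm1.
apply/(containsP tau (p := incr_perm k.+1) (isT : 0 < k.+1) iv ip)/negP.
- case=> f [i [j [oc B ij]]] /(in_box_inc k F) H; rewrite hL in ij.
  have mono := occ_mono oc; case/occurrenceP: oc => _ f2.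
  pose l := mkseq (fun t => (col_time (f (inord (k - t))), col_time (s (f (inord (k - t)))))) k.+1.
  apply: (negP (H l (size_mkseq _ _) _)).
    apply/(sortedP (0, 0)) => t; rewrite size_mkseq => lt; rewrite !nth_mkseq //; last lia.
    by rewrite /goes_sw /= !col_time_ltE mono f2 !pE !inordK; lia.
  apply/allP => p /mapP[t _ ->]; apply/to_fillingP; exists (f (inord (k - t))); split=> //.
  have [l1 l2] := B (inord (k - t)); apply: contraT => nC.
  by have := nC; rewrite /inner -so // (L_down ij).
- move=> nb; suff : ~~ [forall f : {ffun 'I_k.+1 ->
    'I_n}, ~~ (occurrence (incr_perm k.+1) s f && inner (f ord_max))].
    rewrite negb_forall => /existsP[f]; rewrite negbK => /andP[oc Cf].
    exists f, (f ord_max), (s (f ord_max)); split=> //; last by rewrite hL si.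
    move=> a; split; rewrite leqNgt ?(occ_mono oc) -?leqNgt; first by rewrite -ltnS ltn_ord.
    by case/occurrenceP: oc => _ oc; rewrite leqNgt oc !pE -leqNgt -ltnS ltn_ord.
  apply/negP => /forallP H; apply: nb; apply/(in_box_inc k F) => l sl so' ; apply/negP => al.
  have [f0 fE] := points_of_list (l := rev l) (k :=
    k) (etrans (size_rev _) sl) (etrans (all_rev _ _) al).
  have tr : transitive goes_sw by move=> a b c; rewrite /goes_sw; lia.
  have lt (a b : 'I_k.+1) : a < b -> f0 a < f0 b /\ s (f0 a) < s (f0 b).
    move=> ab; have := sorted_ltn_nth tr (0, 0) so' (k - b) (k - a).
    have ra (c : 'I_k.+1) : nth (0, 0) l (k - c) = (col_time (f0 c), col_time (s (f0 c))).
      by rewrite -fE nth_rev sl // subSS.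
    rewrite !inE !sl !ra /goes_sw /= !col_time_ltE; have := ltn_ord a; have := ltn_ord b.
    by move=> h1 h2 /(_ ltac:(lia) ltac:(lia) ltac:(lia)) /andP[].
  have /negP := H [ffun a => f0 a]; apply; apply/andP; split.
    apply/occurrenceP; split=> a b; rewrite !ffunE ?pE; first by case/lt.
    by case: (ltngtP a b) => [/lt[]|/lt[]|/val_inj ->]; lia.
  rewrite ffunE -inner_time_col; apply: (fill_dom F (y := col_time (s (f0 ord_max)))).
  have : nth (0, 0) (rev l) (@ord_max k) \in l by rewrite -mem_rev mem_nth // size_rev sl.
  by move/(allP al); rewrite fE.
Qed.

(** For a decreasing pattern the corner of the rectangle is not a dot: it
combines the position of the last dot and the value of the first. *)
Lemma contains_decr s k : s \in outer_class ->
  contains s (dsum (decr_perm k.+1) tau) = ~~ in_box n k N (to_filling s).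
Proof.
move=> sA; have F := to_fillingE sA; have [iv so si sa] := outer_classP _ sA.
have hL := outer_class_inside sA.
have pE i : decr_perm k.+1 i = rev_ord i by rewrite permE.
have ip : (decr_perm k.+1)^-1%g = decr_perm k.+1.
  apply/permP => i; apply: (perm_inj (s := decr_perm k.+1)); rewrite permKV !pE.
  by rewrite rev_ordK.
apply/(containsP tau (p := decr_perm k.+1) (isT : 0 < k.+1) iv ip)/negP.
- case=> f [i [j [oc B ij]]] /(in_box_dec k F) H; rewrite hL in ij.
  have mono := occ_mono oc; case/occurrenceP: oc => _ f2.
  pose l := mkseq (fun t => (col_time (f (inord t)), col_time (s (f (inord t))))) k.+1.
  apply: (negP (H (col_time i) (col_time j) l _ _ _)).
  + by rewrite col_time_in.
  + by rewrite size_mkseq.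
  + apply/(sortedP (0, 0)) => t; rewrite size_mkseq => lt; rewrite !nth_mkseq //; last lia.
    by rewrite /goes_se /= !col_time_ltE mono f2 !pE /= !inordK; lia.
  apply/allP => p /mapP[t _ ->] /=; have [l1 l2] := B (inord t); rewrite !col_time_le l1 l2 !andbT.
  apply/to_fillingP; exists (f (inord t)); split=> //; apply: contraT => nC.
  by have := nC; rewrite /inner -so // (L_down ij).
- move=> nb; suff : ~~ [forall f : {ffun 'I_k.+1 ->
    'I_n}, ~~ (occurrence (decr_perm k.+1) s f && L (f ord_max) (s (f ord0)))].
    rewrite negb_forall => /existsP[f]; rewrite negbK => /andP[oc Lf].
    exists f, (f ord_max), (s (f ord0)); split=> //; last by rewrite hL.
    move=> a; split; first by rewrite leqNgt (occ_mono oc) -leqNgt -ltnS ltn_ord.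
    by case/occurrenceP: oc => _ oc; rewrite leqNgt oc !pE /= -leqNgt; lia.
  apply/negP => /forallP H; apply: nb; apply/(in_box_dec k F) => a0 b0 l lc sl so';
    apply/negP => al.
  have al1 : all (fun p => to_filling s p.1 p.2) l by apply: sub_all al => p /andP[].
  have [f0 fE] := points_of_list sl al1.
  have tr : transitive goes_se by move=> a b c; rewrite /goes_se; lia.
  have lt (a b : 'I_k.+1) : a < b -> f0 a < f0 b /\ s (f0 b) < s (f0 a).
    move=> ab; have := sorted_ltn_nth tr (0, 0) so' a b.
    rewrite !inE !sl !fE /goes_se /= !col_time_ltE; have := ltn_ord a; have := ltn_ord b.
    by move=> h1 h2 /(_ ltac:(lia) ltac:(lia) ltac:(lia)) /andP[].
  have bd (a : 'I_k.+1) : col_time (f0 a) <= a0 /\ col_time (s (f0 a)) <= b0.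
    have : nth (0, 0) l a \in l by rewrite mem_nth // sl.
    by move/(allP al); rewrite fE /= => /and3P[].
  have /negP := H [ffun a => f0 a]; apply; apply/andP; split.
    apply/occurrenceP; split=> a b; rewrite !ffunE ?pE; first by case/lt.
    have := ltn_ord a; have := ltn_ord b; rewrite /=.
    by case: (ltngtP a b) => [ab|ba|/val_inj ->]; [case: (lt _ _ ab) | case: (lt _ _ ba) |]; lia.
  by rewrite !ffunE -col_time_in; have [? _] := bd ord_max; have [_ ?] := bd ord0; lia.
Qed.

Lemma card_outer_class k : 0 < n ->
  #|[set s in outer_class | avoids s (dsum (incr_perm k.+1) tau)]| =
  #|[set s in outer_class | avoids s (dsum (decr_perm k.+1) tau)]|.
Proof.
move=> n0.
have -> : [set s in outer_class | avoids s (dsum (incr_perm k.+1) tau)] =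
  [set s in outer_class | in_box n N k (to_filling s)].
  by apply/setP => s; rewrite in_set [RHS]in_set; case: (boolP (s \in outer_class)) => // sA;
    rewrite /avoids contains_incr // negbK.
have -> : [set s in outer_class | avoids s (dsum (decr_perm k.+1) tau)] =
  [set s in outer_class | in_box n k N (to_filling s)].
  by apply/setP => s; rewrite in_set [RHS]in_set; case: (boolP (s \in outer_class)) => // sA;
    rewrite /avoids contains_decr // negbK.
apply: (card_fillings_conj inner_time_lt inner_time_excl peak_time_nbr peak_time_next) => //.
- by move=> s; apply: to_fillingE.
- exact: to_filling_inj.
- exact: to_filling_surj.
Qed.
End Class.

(** * The equality of the two numbers *)

Lemma card_by_outer_data n m k (p : 'S_k) (tau : 'S_m) :
  #|AI_av n (dsum p tau)| = \sum_K #|[set s in AI n | outer_data tau s == K &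
    avoids s (dsum p tau)]|.
Proof.
rewrite -sum1_card (partition_big (outer_data tau) xpredT) //=; apply: eq_bigr => K _.
by rewrite -sum1_card; apply: eq_bigl => s; rewrite !inE andbAC -andbA.
Qed.

Theorem theorem1p8 (n k m : nat) (tau : 'S_m) (n_gt0 : 0 < n) (k_gt0 : 0 < k)
    (m_gt0 : 0 < m) :
  #|AI_av n (dsum (incr_perm k) tau)| = #|AI_av n (dsum (decr_perm k) tau)|.
Proof.
case: k k_gt0 => // k _; rewrite !card_by_outer_data; apply: eq_bigr => K _.
case: (pickP [pred s in AI n | outer_data tau s == K]) => [s0|no]; last first.
  by rewrite !eq_card0 // => s; rewrite !inE; have := no s; rewrite /= !inE;
    case: (_ && involution s) => //= ->.
rewrite /= !inE => /andP[/andP[al iv] /eqP <-].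
have E (p : 'S_k.+1) : [set s in AI n | outer_data tau s == outer_data tau s0 &
  avoids s (dsum p tau)] =
   [set s in outer_class tau s0 | avoids s (dsum p tau)].
  by apply/setP => s; rewrite !inE andbA.
by rewrite !E; apply: card_outer_class.
Qed.
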